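(* Let $1\leq p\leq\infty$. (1) Let $\alpha\leq 0$. (a) For any function $\varphi:[0,1)\to\mathbb{R}_+$ with $\varphi(r)\to\infty$ as $r\to 1^-$, there is a hypercyclic function $f\in H(\mathbb{D})$ for $T_\alpha$ and a constant $C>0$ such that $M_p(f,r)\leq C\,\varphi(r)(1-r)^{\alpha}$ for all $0<r<1$ sufficiently close to $1$. (b) There is no hypercyclic function $f\in H(\mathbb{D})$ for $T_\alpha$ for which there exists a constant $C>0$ such that $M_p(f,r)\leq C(1-r)^{\alpha}$ for all $0<r<1$. (2) Let $\alpha>0$. (a) There is a hypercyclic function $f\in H(\mathbb{D})$ for $T_\alpha$ and a constant $C>0$ such that $M_p(f,r)\leq C$ for all $0<r<1$. (b) For any function $\varphi:[0,1)\to\mathbb{R}_+$ with $\varphi(r)\to 0$ as $r\to1^-$, there is no hypercyclic function $f\in H(\mathbb{D})$ for $T_\alpha$ that satisfies $M_p(f,r)\leq\varphi(r)$ for all $0<r<1$.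
   Context: $\mathbb{D}$ is the open unit disc in $\mathbb{C}$ and $H(\mathbb{D})$ is the Fréchet space of analytic functions on $\mathbb{D}$ with the topology of uniform convergence on compact subsets. For $\alpha\in\mathbb{R}$ and $n\ge1$ put $w_n(\alpha)=(1+\frac1n)^{\alpha}$; the weighted Taylor shift $T_\alpha:H(\mathbb{D})\to H(\mathbb{D})$ is $T_\alpha\big(\sum_{k\ge0}a_kz^k\big)=\sum_{k\ge0}a_{k+1}w_{k+1}(\alpha)z^k$. A function $f\in H(\mathbb{D})$ is hypercyclic for $T_\alpha$ if for every non-empty open set $U\subset H(\mathbb{D})$ the set $\{n\in\mathbb{N}: T_\alpha^nf\in U\}$ is infinite. For $0<r<1$, $M_p(f,r)=\big(\frac1{2\pi}\int_0^{2\pi}|f(re^{i\theta})|^p\,d\theta\big)^{1/p}$ if $1\le p<\infty$, and $M_\infty(f,r)=\sup_{0\le t\le2\pi}|f(re^{it})|$. *)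

(* Defs.v *)
From HB Require Import structures.
From mathcomp Require Import all_boot all_order all_algebra.
From mathcomp Require Import complex.
From mathcomp Require Import all_classical all_reals all_analysis.

Set Implicit Arguments.
Unset Strict Implicit.
Unset Printing Implicit Defensive.

Import Order.TTheory GRing.Theory Num.Theory numFieldNormedType.Exports.

Local Open Scope classical_set_scope.
Local Open Scope ring_scope.
Local Open Scope complex_scope.

(* MathComp-Analysis puts the norm topology on every numFieldType K through
   the alias K^o; these instances copy it to the concrete type R[i]. *)
HB.instance Definition _ (R : realType) := PseudoPointedMetric.copy R[i] R[i]^o.
HB.instance Definition _ (R : realType) := NormedModule.copy R[i] R[i]^o.

Section WeightedTaylorShift.
Context {R : realType}.

Definition disc : set R[i] := [set z | `|z| < 1].

Definition analytic_at (f : R[i] -> R[i]) (z0 : R[i]) :=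
  exists a : nat -> R[i],
    \forall z \near z0, [series a k * (z - z0) ^+ k]_k @ \oo --> f z.

(* An element of H(D) is represented by any function on R[i] that is analytic
   at every point of the disc; its values outside the disc are irrelevant to
   all the notions below, and functions that agree on the disc have the same
   neighbourhoods. *)
Definition HD : set (R[i] -> R[i]) := [set f | forall z, disc z -> analytic_at f z].

(* Topology of H(D): the trace on HD of the topology of uniform convergence on
   the compact subsets of the disc. *)
Definition HD_open (U : set (R[i] -> R[i])) :=
  exists2 V : set {family compactly_in disc, R[i] -> R[i]},
    open V & U = V `&` HD.

(* The sequence a such that f z = \sum_k a_k z^k on the whole disc; it exists
   and is unique whenever f is in HD. *)
Definition taylor (f : R[i] -> R[i]) : nat -> R[i] :=
  get [set a : nat -> R[i] |
        forall z, disc z -> [series a k * z ^+ k]_k @ \oo --> f z].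

Definition weight (alpha : R) (n : nat) : R := (1 + n%:R^-1) `^ alpha.

Definition taylor_shift (alpha : R) (f : R[i] -> R[i]) : R[i] -> R[i] :=
  fun z => limn [series taylor f k.+1 * (weight alpha k.+1)%:C * z ^+ k]_k.

Definition hypercyclic (alpha : R) (f : R[i] -> R[i]) :=
  HD f /\
  forall U : set (R[i] -> R[i]), HD_open U -> U !=set0 ->
    infinite_set [set n | U (iter n (taylor_shift alpha) f)].

Definition circle_pt (r t : R) : R[i] := (r * cos t) +i* (r * sin t).

Definition Mp (p : \bar R) (f : R[i] -> R[i]) (r : R) : R :=
  match p with
  | q%:E => ((2 * pi)^-1 *
      \int[lebesgue_measure]_(t in `[0, 2 * pi])
         (Normc.normc (f (circle_pt r t)) `^ q)) `^ q^-1
  | +oo%E => sup [set Normc.normc (f (circle_pt r t)) | t in `[0, 2 * pi]]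
  | -oo%E => 0
  end.

End WeightedTaylorShift.

(* Main.v *)
Require Import Defs.
From HB Require Import structures.
From mathcomp Require Import all_boot all_order all_algebra.
From mathcomp Require Import complex.
From mathcomp Require Import all_classical all_reals all_analysis.
From mathcomp Require Import measurable_realfun.
From mathcomp Require Import ring lra zify.
Import Order.TTheory GRing.Theory Num.Theory numFieldNormedType.Exports.
Local Open Scope classical_set_scope.
Local Open Scope ring_scope.

(** Write [f = sum_k a_k z^k].  The weights telescope, so the [k]-th coefficient
    of [T_alpha^n f] is [a_(k+n) ((k+n+1)/(k+1))^alpha]: in the coordinates
    [b_k = a_k (k+1)^alpha] the operator is the plain backward shift.

    Both negative statements come from evaluation at [0].  As
    [T_alpha^n f (0) = b_n], a hypercyclic [f] has an unbounded sequence [b]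
    ([hypercyclic_unbounded]).  On the other hand Cauchy's inequality
    [|a_n| r^n <= M_1(f, r) <= M_p(f, r)] ([coef_le_Mp]) turns the bound
    [C (1 - r)^alpha] into a bound on [b_n], by taking [r] at distance of order
    [1/n] from [1], and turns a bound tending to [0] into [a_n = 0].

    Both positive statements use one construction.  Enumerate the polynomials
    with Gaussian rational coefficients, each infinitely often, and write the
    [b]-coordinates of the [j]-th one, as a block, into [b] from position [n_j]
    on.  Then [T_alpha^(n_j) f] is the [j]-th polynomial plus the later blocks,
    moved to degrees at least [n_i - n_j], [i > j]; if the [n_j] are sparse
    enough, that remainder is small on a disc that grows with [j], so the orbit
    of [f] is dense ([block_fun_hypercyclic]).  It remains to see how large the
    blocks are.  A block placed at [n] has coefficients of order [n^(-alpha)]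
    times a constant [A_j] of the block.  If [alpha > 0] these tend to [0], and
    for sparse [n_j] the series of the suprema converges
    ([bounded_hypercyclic]).  If [alpha <= 0], then
    [n^(-alpha) r^n <= C (1 - r)^alpha] for all [n], while for fixed [r < 1] the
    contribution of the block is negligible once [n] is large; choosing [n_j]
    large enough that block [j] is felt only for those [r] at which [phi]
    exceeds [A_0 + ... + A_j] gives the required bound
    ([slow_growth_hypercyclic]).  In both cases the supremum over the circle
    bounds [M_p] for every [p] ([Mp_le]).

    Functions of [H(D)] are given as locally analytic ones, so all this rests on
    the existence of a Taylor expansion on the whole disc ([global_taylor]).  It
    is obtained without contour integrals, following Weierstrass: power series
    can be recentred ([recenter]), Cauchy's inequality holds for a power series
    because integration over a circle isolates each coefficient
    ([cauchy_mean]), and if the expansion at [0] represents [f] up to a radius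
    [r < 1], a uniform bound on the local expansions of [f] over the compact
    disc of radius [r] pushes it beyond [r]. *)

Set Implicit Arguments.
Unset Strict Implicit.
Unset Printing Implicit Defensive.

Local Notation nrm := Normc.normc.

(** * Modulus and convergence of complex sequences *)

Section ComplexModulus.
Context {R : realType}.
Implicit Types (z w : R[i]) (u : nat -> R[i]).

Lemma normE z : `|z| = (nrm z)%:C%C.
Proof. by case: z => a b; rewrite normc_def. Qed.

Lemma nrm_ge0 z : 0 <= nrm z.
Proof. by case: z => a b; rewrite /= sqrtr_ge0. Qed.

Lemma nrmD z w : nrm (z + w) <= nrm z + nrm w.
Proof. exact: le_normcD. Qed.

Lemma nrmN z : nrm (- z) = nrm z.
Proof. exact: normcN. Qed.

Lemma nrmB z w : nrm (z - w) <= nrm z + nrm w.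
Proof. by rewrite -(nrmN w) nrmD. Qed.

Lemma nrm_distC z w : nrm (z - w) = nrm (w - z).
Proof. by rewrite -nrmN opprB. Qed.

Lemma nrm_dist z w : nrm z <= nrm w + nrm (z - w).
Proof. by rewrite -[z in nrm z](addrNK w) addrC nrmD. Qed.

Lemma nrmX z n : nrm (z ^+ n) = nrm z ^+ n.
Proof.
elim: n => [|n IH]; first by rewrite !expr0 Normc.normc1.
by rewrite !exprS Normc.normcM IH.
Qed.

Lemma nrm_eq0 z : nrm z = 0 -> z = 0.
Proof. exact: Normc.eq0_normc. Qed.

Lemma nrmR (x : R) : nrm x%:C%C = `|x|.
Proof. by rewrite /= expr0n /= addr0 sqrtr_sqr. Qed.

Lemma nrm_nat n : nrm (n%:R : R[i]) = n%:R.
Proof. by rewrite -[n%:R](rmorph_nat (real_complex R)) nrmR ger0_norm. Qed.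

Lemma nrm_sum I (r : seq I) (P : pred I) (F : I -> R[i]) :
  nrm (\sum_(i <- r | P i) F i) <= \sum_(i <- r | P i) nrm (F i).
Proof.
elim/big_ind2: _ => //; first by rewrite Normc.normc0.
by move=> x1 x2 y1 y2 h1 h2; apply: le_trans (nrmD _ _) (lerD _ _).
Qed.

Lemma normr_Re z : `|complex.Re z| <= nrm z.
Proof. by have := normc_ge_Re z; rewrite normE lecR. Qed.

Lemma nrm_le z : nrm z <= `|complex.Re z| + `|complex.Im z|.
Proof.
rewrite [z in nrm z]complexE; apply: le_trans (nrmD _ _) _.
rewrite Normc.normcM !nrmR lerD2l ler_piMl //= expr0n /= add0r expr1n sqrtr1.
by [].
Qed.

Lemma normr_Im z : `|complex.Im z| <= nrm z.
Proof.
have := normr_Re (z * 'i%C); rewrite ReiNIm normrN Normc.normcM.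
by rewrite /= expr0n add0r expr1n sqrtr1 mulr1.
Qed.

(** The norm of [R[i]] takes values in [R[i]]; testing convergence with the real
    modulus keeps all estimates in the ordered field [R]. *)
Lemma cvgC_P T (F : set_system T) (FF : Filter F) (u : T -> R[i]) (l : R[i]) :
  (u @ F --> l) <-> (forall e : R, 0 < e -> \forall n \near F, nrm (u n - l) <= e).
Proof.
split=> [ul e e0|H].
  have e0' : 0 < e%:C%C by rewrite ltcR.
  move/cvgrPdist_le : ul => /(_ _ e0'); apply: filterS => n.
  by rewrite normE lecR nrm_distC.
apply/cvgrPdist_le => e e0.
have er : e = (complex.Re e)%:C%C by rewrite RRe_real// gtr0_real.
have e0' : 0 < complex.Re e by rewrite -ltcR -er.
by apply: filterS (H _ e0') => n; rewrite normE er lecR nrm_distC.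
Qed.

Lemma nbhsC_P z (A : set R[i]) :
  nbhs z A <-> exists2 e : R, 0 < e & forall w, nrm (w - z) < e -> A w.
Proof.
split=> [/nbhs_ballP[e /= e0 zA]|[e e0 zA]].
  have er : e = (complex.Re e)%:C%C by rewrite RRe_real// gtr0_real.
  exists (complex.Re e); first by rewrite -ltcR -er.
  by move=> w wz; apply: zA; rewrite /ball /= normE er ltcR nrm_distC.
apply/nbhs_ballP; exists e%:C%C; first by rewrite /= ltcR.
by move=> w; rewrite /ball /= normE ltcR nrm_distC => /zA.
Qed.

Lemma cvgC_bound u (l c : R[i]) (B : R) N : u @ \oo --> l ->
  (forall n, (N <= n)%N -> nrm (u n - c) <= B) -> nrm (l - c) <= B.
Proof.
move=> /cvgC_P ul uB; apply/ler_addgt0Pr => e e0.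
have [m _ /(_ (maxn m N)) /=] := ul _ e0; rewrite leq_maxl => /(_ isT) h1.
have h2 := uB (maxn m N) (leq_maxr _ _).
rewrite [l - c](_ : _ = (u (maxn m N) - c) - (u (maxn m N) - l)); last by ring.
exact: le_trans (nrmB _ _) (lerD _ _).
Qed.

Lemma cvgC_unique u (l l' : R[i]) : u @ \oo --> l -> u @ \oo --> l' -> l = l'.
Proof. by move=> ul ul'; apply: (cvg_unique _ ul ul'); apply: norm_hausdorff. Qed.

Lemma limC_eq u (l : R[i]) : u @ \oo --> l -> limn u = l.
Proof. by move=> ul; apply: cvg_lim => //; exact: norm_hausdorff. Qed.

Lemma cvgC_re_im u (x y : R) :
  (fun n => complex.Re (u n)) @ \oo --> x ->
  (fun n => complex.Im (u n)) @ \oo --> y -> u @ \oo --> (x +i* y)%C.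
Proof.
move=> /cvgrPdist_le ux /cvgrPdist_le uy; apply/cvgC_P => e e0.
have e2 : 0 < e / 2 by rewrite divr_gt0.
apply: filterS2 (ux _ e2) (uy _ e2) => n h1 h2; rewrite [e]splitr.
apply: le_trans (nrm_le _) _; rewrite distrC in h1; rewrite distrC in h2.
by case: (u n) h1 h2 => a b h1 h2; apply: lerD.
Qed.

Lemma geometric_sum_le (A q : R) m n : 0 <= A -> 0 <= q -> q < 1 ->
  \sum_(m <= k < n) A * q ^+ k <= A * q ^+ m / (1 - q).
Proof.
move=> A0 q0 q1; have [nm|/ltnW mn] := leqP n m.
  rewrite big_geq//; apply: divr_ge0; first exact: mulr_ge0 _ (exprn_ge0 _ _).
  by rewrite subr_ge0 ltW.
rewrite -mulr_sumr -mulrA ler_wpM2l// ler_pdivlMr ?subr_gt0//.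
suff -> : (\sum_(m <= k < n) q ^+ k) * (1 - q) = q ^+ m - q ^+ n.
  by rewrite gerBl exprn_ge0.
rewrite mulr_suml (eq_bigr (fun k => - (q ^+ k.+1 - q ^+ k))).
  by rewrite sumrN telescope_sumr// opprB.
by move=> k _; rewrite mulrBr mulr1 -exprSr opprB.
Qed.

(** The explicit error term is what makes the later interchanges of limits
    elementary. *)
Lemma geometric_series u (A q : R) : 0 <= q -> q < 1 ->
  (forall k, nrm (u k) <= A * q ^+ k) ->
  exists2 l, series u @ \oo --> l &
    forall N, nrm (series u N - l) <= A * q ^+ N / (1 - q).
Proof.
move=> q0 q1 uA.
have A0 : 0 <= A by have := uA 0%N; rewrite expr0 mulr1; apply: le_trans (nrm_ge0 _).
have real (v : nat -> R) : (forall k, `|v k| <= A * q ^+ k) -> cvgn (series v).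
  move=> vA; apply: normed_cvg.
  apply: (@series_le_cvg _ _ (geometric A q)) => //=.
  - by move=> n; rewrite mulr_ge0 ?exprn_ge0.
  - by apply: is_cvg_geometric_series; rewrite ger0_norm.
have cre : cvgn (series (fun k => complex.Re (u k))).
  by apply: real => k; apply: le_trans (normr_Re _) _.
have cim : cvgn (series (fun k => complex.Im (u k))).
  by apply: real => k; apply: le_trans (normr_Im _) _.
have Ruv n : complex.Re (series u n) = series (fun k => complex.Re (u k)) n.
  rewrite /series /=; elim: n => [|n IH]; first by rewrite !big_geq.
  by rewrite !big_nat_recr //= -IH; case: (\sum_(0 <= _ < _) _) => ? ?; case: (u n).
have Iuv n : complex.Im (series u n) = series (fun k => complex.Im (u k)) n.
  rewrite /series /=; elim: n => [|n IH]; first by rewrite !big_geq.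
  by rewrite !big_nat_recr //= -IH; case: (\sum_(0 <= _ < _) _) => ? ?; case: (u n).
have cl : series u @ \oo --> (limn (series (fun k => complex.Re (u k))) +i*
    limn (series (fun k => complex.Im (u k))))%C.
  apply: cvgC_re_im.
  - by under eq_fun do rewrite Ruv.
  - by under eq_fun do rewrite Iuv.
eexists; first exact: cl.
move=> N; rewrite nrm_distC; apply: (cvgC_bound cl (N := N)) => n Nn.
rewrite sub_series_geq//; apply: le_trans (nrm_sum _ _ _) _.
apply: le_trans _ (geometric_sum_le N n A0 q0 q1).
by apply: ler_sum => k _; exact: uA.
Qed.

End ComplexModulus.

(** * Integration over a period *)

Section CircleMeans.
Context {R : realType}.
Implicit Types (h g : R -> R) (r t x y : R).

Local Notation I02 := `[0, 2 * pi]%classic.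

Lemma twopi_gt0 : 0 < 2 * pi :> R.
Proof. by rewrite mulr_gt0 ?pi_gt0. Qed.

Lemma circle_integrable h : continuous h ->
  lebesgue_measure.-integrable I02 (EFin \o h).
Proof.
move=> ch; apply: continuous_compact_integrable; first exact: segment_compact.
exact: continuous_subspaceT.
Qed.

Definition circle_int h : R := \int[lebesgue_measure]_(t in I02) h t.

Lemma circle_intD h g : continuous h -> continuous g ->
  circle_int (fun t => h t + g t) = circle_int h + circle_int g.
Proof. by move=> ch cg; apply: RintegralD => //; apply: circle_integrable. Qed.

Lemma circle_intZ h x : continuous h ->
  circle_int (fun t => x * h t) = x * circle_int h.
Proof. by move=> ch; apply: RintegralZl => //; apply: circle_integrable. Qed.

Lemma circle_int_cst x : circle_int (fun=> x) = 2 * pi * x.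
Proof.
rewrite /circle_int Rintegral_cst//= lebesgue_measure_itv /= lte_fin twopi_gt0.
by rewrite -EFinB /= subr0 mulrC.
Qed.

Lemma le_circle_int h g : continuous h -> continuous g ->
  (forall t, h t <= g t) -> circle_int h <= circle_int g.
Proof. by move=> ch cg hg; apply: le_Rintegral => //; apply: circle_integrable. Qed.

Lemma continuous_sum n (h : nat -> R -> R) : (forall k, continuous (h k)) ->
  continuous (fun t => \sum_(0 <= k < n) h k t).
Proof.
move=> ch; elim: n => [|n IH] t.
  by under eq_fun do rewrite big_geq//; exact: cvg_cst.
by under eq_fun do rewrite big_nat_recr//=; apply: cvgD; [exact: IH|exact: ch].
Qed.

Lemma circle_int_sum n (h : nat -> R -> R) : (forall k, continuous (h k)) ->
  circle_int (fun t => \sum_(0 <= k < n) h k t) = \sum_(0 <= k < n) circle_int (h k).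
Proof.
move=> ch; elim: n => [|n IH].
  by under eq_fun do rewrite big_geq//; rewrite circle_int_cst mulr0 big_geq.
under eq_fun do rewrite big_nat_recr//=.
by rewrite circle_intD// ?IH ?big_nat_recr//; apply: continuous_sum.
Qed.

Lemma cos_sin_nat2pi n :
  cos (n%:R * (2 * pi)) = 1 :> R /\ sin (n%:R * (2 * pi)) = 0 :> R.
Proof.
elim: n => [|n [c s]]; first by rewrite mul0r cos0 sin0.
rewrite -natr1 mulrDl mul1r [2 * pi]mulr_natl.
by rewrite sinD2pi cosD2pi -[pi *+ 2]mulr_natl c s.
Qed.

Lemma continuous_mulc (m : R) : continuous (fun t : R => m * t).
Proof. by move=> t; apply: cvgM; [exact: cvg_cst|exact: cvg_id]. Qed.

Lemma continuous_cosM (m : R) : continuous (fun t : R => cos (m * t)).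
Proof.
by move=> t; apply: (@continuous_comp _ _ _ (fun t : R => m * t) (@cos R));
  [exact: continuous_mulc|exact: continuous_cos].
Qed.

Lemma continuous_sinM (m : R) : continuous (fun t : R => sin (m * t)).
Proof.
by move=> t; apply: (@continuous_comp _ _ _ (fun t : R => m * t) (@sin R));
  [exact: continuous_mulc|exact: continuous_sin].
Qed.

Lemma continuous_trig (m x y : R) :
  continuous (fun t : R => x * cos (m * t) - y * sin (m * t)).
Proof.
move=> t; apply: cvgB; apply: cvgM; try exact: cvg_cst.
- exact: continuous_cosM.
- exact: continuous_sinM.
Qed.

Lemma circle_int_trig k n x y : k != n ->
  circle_int (fun t => x * cos ((k%:R - n%:R) * t) - y * sin ((k%:R - n%:R) * t)) = 0.
Proof.
move=> kn; set m : R := k%:R - n%:R.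
have m0 : m != 0 by rewrite subr_eq0 eqr_nat.
pose F t : R := m^-1 * (x * sin (m * t) + y * cos (m * t)).
have dF t : is_derive t 1 F (x * cos (m * t) - y * sin (m * t)).
  rewrite /F; apply: is_derive_eq.
  rewrite /GRing.scale /= !(mulr0, addr0, mul0r, add0r, mulr1).
  by field.
have cF t : {for t, continuous F}.
  by apply: differentiable_continuous; apply/derivable1_diffP; exact: ex_derive.
rewrite /circle_int /Rintegral (@continuous_FTC2 R _ F); first last.
- by move=> t _; rewrite derive1E; apply: derive_val.
- split.
  + by move=> t _; exact: ex_derive.
  + apply: cvg_at_right_filter; exact: cF.
  + apply: cvg_at_left_filter; exact: cF.
- apply: continuous_subspaceT; exact: continuous_trig.
- exact: twopi_gt0.
have [ck sk] := cos_sin_nat2pi k; have [cn sn] := cos_sin_nat2pi n.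
have cm : cos (m * (2 * pi)) = 1.
  by rewrite /m mulrBl cosB ck sk cn sn !mulr0 addr0 mulr1.
have sm : sin (m * (2 * pi)) = 0 by rewrite /m mulrBl sinB ck sk cn sn !(mulr0, mul0r) subr0.
by rewrite -EFinB /= /F cm sm !mulr0 cos0 sin0 mulr0 subrr.
Qed.

End CircleMeans.

(** * Power series and Cauchy's inequality *)

Section PowerSeries.
Context {R : realType}.
Implicit Types (a b : nat -> R[i]) (z w l : R[i]) (r s t rho M : R).

Definition psums a z : nat -> R[i] := series (fun k => a k * z ^+ k).

Lemma psums_coef_bound a z l : psums a z @ \oo --> l ->
  exists M, forall k, nrm (a k) * nrm z ^+ k <= M.
Proof.
move=> /cvgC_P /(_ 1 ltr01)[N _ aN].
exists (2 + \sum_(0 <= k < N) nrm (a k) * nrm z ^+ k) => k.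
have t0 j : 0 <= nrm (a j) * nrm z ^+ j by rewrite mulr_ge0 ?exprn_ge0 ?nrm_ge0.
have [kN|Nk] := ltnP k N.
  rewrite (@big_cat_nat _ _ _ k.+1) //= big_nat_recr //=.
  have h1 : 0 <= \sum_(0 <= i < k) nrm (a i) * nrm z ^+ i by apply: sumr_ge0.
  have h2 : 0 <= \sum_(k.+1 <= i < N) nrm (a i) * nrm z ^+ i by apply: sumr_ge0.
  lra.
apply: (@le_trans _ _ 2); last by rewrite lerDl sumr_ge0.
rewrite -nrmX -Normc.normcM.
have -> : a k * z ^+ k = (psums a z k.+1 - l) - (psums a z k - l).
  by rewrite /psums /series /= big_nat_recr //=; ring.
apply: le_trans (nrmB _ _) _; rewrite (_ : 2 = 1 + 1)//; apply: lerD; apply: aN => //=.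
exact: leqW.
Qed.

Lemma psums_cvg a rho M z : 0 < rho -> nrm z < rho ->
  (forall k, nrm (a k) * rho ^+ k <= M) ->
  exists2 l, psums a z @ \oo --> l &
    forall N, nrm (psums a z N - l) <= M * (nrm z / rho) ^+ N / (1 - nrm z / rho).
Proof.
move=> rho0 zr aM; apply: geometric_series.
- by rewrite divr_ge0 ?nrm_ge0 ?ltW.
- by rewrite ltr_pdivrMr// mul1r.
move=> k; rewrite Normc.normcM nrmX expr_div_n mulrA ler_pdivlMr ?exprn_gt0//.
by rewrite mulrAC ler_wpM2r// exprn_ge0// nrm_ge0.
Qed.

Lemma circle_ptM r t s (u : R) :
  circle_pt r t * circle_pt s u = circle_pt (r * s) (t + u).
Proof.
rewrite /circle_pt cosD sinD; apply/eqP; rewrite eq_complex /=.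
by apply/andP; split; apply/eqP; ring.
Qed.

Lemma circle_ptX r t k : circle_pt r t ^+ k = circle_pt (r ^+ k) (k%:R * t).
Proof.
elim: k => [|k IH]; last by rewrite !exprS IH circle_ptM -natr1 mulrDl mul1r addrC.
by rewrite !expr0 mul0r /circle_pt cos0 sin0 mul1r mulr0.
Qed.

Lemma nrm_circle_pt r t : 0 <= r -> nrm (circle_pt r t) = r.
Proof.
move=> r0; rewrite /= !exprMn -mulrDr cos2Dsin2 mulr1 sqrtr_sqr.
exact: ger0_norm.
Qed.

Lemma Re_mul_circle_pt z s (u : R) : complex.Re (z * circle_pt s u) =
  (complex.Re z * s) * cos u - (complex.Im z * s) * sin u.
Proof. by case: z => x y /=; ring. Qed.

Lemma Im_mul_circle_pt z s (u : R) : complex.Im (z * circle_pt s u) =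
  (complex.Re z * s) * sin u + (complex.Im z * s) * cos u.
Proof. by case: z => x y /=; ring. Qed.

Lemma Re_sum n (F : nat -> R[i]) :
  complex.Re (\sum_(0 <= k < n) F k) = \sum_(0 <= k < n) complex.Re (F k).
Proof.
elim: n => [|n IH]; first by rewrite !big_geq.
by rewrite !big_nat_recr //= -IH; case: (\sum_(0 <= _ < _) _) => ? ?; case: (F n).
Qed.

Lemma Im_sum n (F : nat -> R[i]) :
  complex.Im (\sum_(0 <= k < n) F k) = \sum_(0 <= k < n) complex.Im (F k).
Proof.
elim: n => [|n IH]; first by rewrite !big_geq.
by rewrite !big_nat_recr //= -IH; case: (\sum_(0 <= _ < _) _) => ? ?; case: (F n).
Qed.

Lemma continuous_nrm_psums a r N :
  continuous (fun t => nrm (psums a (circle_pt r t) N)).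
Proof.
have E t : nrm (psums a (circle_pt r t) N) = Num.sqrt (
   (\sum_(0 <= k < N) ((complex.Re (a k) * r ^+ k) * cos (k%:R * t)
       - (complex.Im (a k) * r ^+ k) * sin (k%:R * t))) ^+ 2 +
   (\sum_(0 <= k < N) ((complex.Re (a k) * r ^+ k) * sin (k%:R * t)
       + (complex.Im (a k) * r ^+ k) * cos (k%:R * t))) ^+ 2).
  rewrite (_ : nrm _ = Num.sqrt (complex.Re (psums a (circle_pt r t) N) ^+ 2 +
     complex.Im (psums a (circle_pt r t) N) ^+ 2)); last by case: (psums _ _ _).
  rewrite /psums /series /= Re_sum Im_sum.
  by congr (Num.sqrt (_ ^+ 2 + _ ^+ 2)); apply: eq_bigr => k _;
    rewrite circle_ptX ?Re_mul_circle_pt ?Im_mul_circle_pt.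
move=> t; rewrite /continuous_at; under eq_fun do rewrite E.
rewrite E.
apply: (@continuous_comp _ _ _ (fun t => _) (@Num.sqrt R)); last exact: sqrt_continuous.
apply: cvgD; apply: cvgM; apply: continuous_sum => k u;
  apply: cvgD; rewrite /=; do ?apply: cvgN; apply: cvgM; try exact: cvg_cst;
  by [exact: continuous_cosM|exact: continuous_sinM].
Qed.

Lemma continuous_uniform_limit (h : R -> R) (g : nat -> R -> R) (e : R^nat) :
  (forall N, continuous (g N)) -> e @ \oo --> 0 ->
  (forall N t, `|h t - g N t| <= e N) -> continuous h.
Proof.
move=> cg e0 hg t; apply/cvgrPdist_le => d d0.
have d3 : 0 < d / 3 by rewrite divr_gt0.
have [N _ /(_ N (leqnn N)) eN] := (cvgr0Pnorm_le _).1 e0 _ d3.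
have {}eN : e N <= d / 3 by apply: le_trans (ler_norm _) eN.
have gN : \forall u \near t, `|g N t - g N u| <= d / 3.
  exact: (cvgrPdist_le _ _).1 (cg N t) _ d3.
apply: filterS gN => u hu; have h1 := hg N t; have h2 := hg N u.
by move: hu h1 h2; rewrite !ler_norml => /andP[? ?] /andP[? ?] /andP[? ?]; lra.
Qed.

(** The error depends on [r] only, so partial sums converge uniformly on the
    circle and continuity and integrals pass to the limit. *)
Lemma psums_circle_tail a rho M r (f : R[i] -> R[i]) : 0 <= r -> r < rho ->
  (forall k, nrm (a k) * rho ^+ k <= M) ->
  (forall z, nrm z = r -> psums a z @ \oo --> f z) ->
  exists2 e : R^nat, e @ \oo --> 0 &
    forall N t, nrm (psums a (circle_pt r t) N - f (circle_pt r t)) <= e N.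
Proof.
move=> r0 rrho aM af; have rho0 : 0 < rho by apply: le_lt_trans rrho.
exists (geometric (M / (1 - r / rho)) (r / rho)).
  apply: cvg_geometric; rewrite ger0_norm; first by rewrite ltr_pdivrMr ?mul1r.
  exact: divr_ge0 (ltW rho0).
move=> N t; have nr : nrm (circle_pt r t) = r by rewrite nrm_circle_pt.
have := @psums_cvg a rho M (circle_pt r t) rho0; rewrite nr => /(_ rrho aM)[l al +].
by rewrite (cvgC_unique (af _ nr) al) => /(_ N); rewrite /= mulrAC.
Qed.

Lemma continuous_nrm_circle a rho M r (f : R[i] -> R[i]) : 0 <= r -> r < rho ->
  (forall k, nrm (a k) * rho ^+ k <= M) ->
  (forall z, nrm z = r -> psums a z @ \oo --> f z) ->
  continuous (fun t => nrm (f (circle_pt r t))).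
Proof.
move=> r0 rrho aM af; have [e e0 he] := psums_circle_tail r0 rrho aM af.
apply: (continuous_uniform_limit (fun N => @continuous_nrm_psums a r N) e0).
move=> N t; apply: le_trans (he N t); rewrite ler_norml.
have h1 := nrm_dist (f (circle_pt r t)) (psums a (circle_pt r t) N).
have h2 := nrm_dist (psums a (circle_pt r t) N) (f (circle_pt r t)).
by rewrite nrm_distC in h1; apply/andP; split; lra.
Qed.

(** Integrating [Re (conj(a_n) e^(-int) s_N(r e^(it)))], where [s_N] is a partial
    sum, leaves only [2 pi |a_n|^2 r^n].  The factor [conj(a_n)], in place of a
    unimodular one, makes the surviving term real and non-negative, so that
    only integrals of real functions occur. *)
Lemma cauchy_mean a rho M r n (f : R[i] -> R[i]) : 0 <= r -> r < rho ->
  (forall k, nrm (a k) * rho ^+ k <= M) ->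
  (forall z, nrm z = r -> psums a z @ \oo --> f z) ->
  2 * pi * (nrm (a n) * r ^+ n) <= circle_int (fun t => nrm (f (circle_pt r t))).
Proof.
move=> r0 rrho aM af.
have ch := continuous_nrm_circle r0 rrho aM af.
set I := circle_int _.
have [an0|/eqP an0] := eqVneq (nrm (a n)) 0.
  rewrite an0 mul0r mulr0; apply: Rintegral_ge0 => t _; exact: nrm_ge0.
have an_gt0 : 0 < nrm (a n) by rewrite lt_def nrm_ge0 andbT; apply/eqP.
have [e e0 he] := psums_circle_tail r0 rrho aM af.
have key N : (n < N)%N -> 2 * pi * (nrm (a n) * r ^+ n) <= I + 2 * pi * e N.
  move=> nN.
  pose v k := conjc (a n) * a k.
  pose h k t := (complex.Re (v k) * r ^+ k) * cos ((k%:R - n%:R) * t)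
     - (complex.Im (v k) * r ^+ k) * sin ((k%:R - n%:R) * t).
  have chk k : continuous (h k) by exact: continuous_trig.
  have intE : circle_int (fun t => \sum_(0 <= k < N) h k t) =
      nrm (a n) * (2 * pi * (nrm (a n) * r ^+ n)).
    rewrite circle_int_sum// (bigD1_seq n) ?mem_index_iota ?iota_uniq//=.
    rewrite big1_seq ?addr0; last by move=> k /andP[kn _]; apply: circle_int_trig.
    rewrite (_ : h n = fun=> nrm (a n) ^+ 2 * r ^+ n).
      by rewrite circle_int_cst; ring.
    apply/funext => t; rewrite /h subrr mul0r cos0 sin0 mulr0 subr0 mulr1.
    congr (_ * _); rewrite /v; case: (a n) => x y /=.
    by rewrite sqr_sqrtr ?addr_ge0 ?sqr_ge0//; ring.
  have : circle_int (fun t => \sum_(0 <= k < N) h k t) <=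
      circle_int (fun t => nrm (a n) * (nrm (f (circle_pt r t)) + e N)).
    apply: le_circle_int.
    - exact: continuous_sum.
    - move=> t; apply: cvgM; first exact: cvg_cst.
      by apply: cvgD; [exact: ch|exact: cvg_cst].
    move=> t.
    have -> : \sum_(0 <= k < N) h k t = complex.Re
        (conjc (a n) * circle_pt 1 (- n%:R * t) * psums a (circle_pt r t) N).
      rewrite /psums /series /= mulr_sumr Re_sum; apply: eq_bigr => k _.
      rewrite circle_ptX.
      rewrite (_ : _ * _ = v k * (circle_pt 1 (- n%:R * t) * circle_pt (r ^+ k) (k%:R * t))).
        by rewrite circle_ptM Re_mul_circle_pt mul1r -mulrDl [- _ + _]addrC.
      by rewrite /v; ring.
    apply: le_trans (ler_norm _) _; apply: le_trans (normr_Re _) _.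
    rewrite !Normc.normcM nrm_circle_pt// mulr1.
    have -> : nrm (conjc (a n)) = nrm (a n) by case: (a n) => x y /=; rewrite sqrrN.
    rewrite ler_wpM2l ?nrm_ge0//; apply: le_trans (nrm_dist _ (f (circle_pt r t))) _.
    by rewrite lerD2l.
  rewrite intE circle_intZ; last by move=> t; apply: cvgD; [exact: ch|exact: cvg_cst].
  rewrite circle_intD//; last by move=> t; exact: cvg_cst.
  by rewrite circle_int_cst ler_pM2l.
apply/ler_addgt0Pr => d d0.
have d2 : 0 < d / (2 * pi) by rewrite divr_gt0 ?twopi_gt0.
have [N _ eN] := (cvgr0Pnorm_le _).1 e0 _ d2.
have := eN (maxn N n.+1) (leq_maxl _ _); have := key (maxn N n.+1) (leq_maxr _ _).
set m := maxn _ _ => h1 h2; apply: le_trans h1 _; rewrite lerD2l.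
rewrite -ler_pdivlMl ?twopi_gt0// mulrC.
exact: le_trans (ler_norm _) h2.
Qed.

Lemma cauchy_sup a rho M r n (f : R[i] -> R[i]) (B : R) : 0 <= r -> r < rho ->
  (forall k, nrm (a k) * rho ^+ k <= M) ->
  (forall z, nrm z = r -> psums a z @ \oo --> f z) ->
  (forall z, nrm z = r -> nrm (f z) <= B) ->
  nrm (a n) * r ^+ n <= B.
Proof.
move=> r0 rrho aM af fB.
have h := cauchy_mean n r0 rrho aM af.
rewrite -(ler_pM2l (@twopi_gt0 R)); apply: le_trans h _.
rewrite -circle_int_cst; apply: le_circle_int.
- exact: continuous_nrm_circle aM af.
- by move=> t; exact: cvg_cst.
- by move=> t; apply: fB; rewrite nrm_circle_pt.
Qed.

(** Cauchy's inequality with bound [0] for the coefficients [a - b]. *)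
Lemma psums_unique a b rho (f : R[i] -> R[i]) : 0 < rho ->
  (forall z, nrm z < rho -> psums a z @ \oo --> f z) ->
  (forall z, nrm z < rho -> psums b z @ \oo --> f z) -> a = b.
Proof.
move=> rho0 af bf; apply/funext => n.
have r2 : 0 < rho / 2 by rewrite divr_gt0.
have r3 : 0 < rho / 3 by rewrite divr_gt0.
have r23 : rho / 3 < rho / 2 by lra.
have r2r : rho / 2 < rho by lra.
have n2 : nrm (rho / 2)%:C%C = rho / 2 by rewrite nrmR gtr0_norm.
have abf z : nrm z < rho -> psums (fun k => a k - b k) z @ \oo --> (fun=> 0 : R[i]) z.
  move=> zr; rewrite /= -(subrr (f z)).
  rewrite (_ : psums _ _ = fun N => psums a z N - psums b z N).
    by apply: cvgB; [exact: af|exact: bf].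
  apply/funext => N; rewrite /psums /series /= -sumrB.
  by apply: eq_bigr => k _; rewrite mulrBl.
have [|M HM] := @psums_coef_bound (fun k => a k - b k) (rho / 2)%:C%C 0.
  by apply: abf; rewrite n2.
rewrite n2 in HM.
have := @cauchy_sup _ _ _ _ n _ 0 (ltW r3) r23 HM.
move=> /(_ (fun=> 0)); rewrite Normc.normc0 => h.
have {}h : nrm (a n - b n) * (rho / 3) ^+ n <= 0.
  by apply: h => // z zr; apply: abf; rewrite zr; lra.
apply/eqP; rewrite -subr_eq0; apply/eqP/nrm_eq0.
apply/eqP; rewrite eq_le nrm_ge0 andbT.
by move: h; rewrite pmulr_lle0// exprn_gt0.
Qed.

End PowerSeries.

(** * Recentring power series *)

Section Recentering.
Context {R : realType}.
Implicit Types (a b : nat -> R[i]) (z w l : R[i]) (r s t rho M : R).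

Lemma binomial_term_le (x y : R) n k : 0 <= x -> 0 <= y ->
  'C(n + k, n)%:R * x ^+ k * y ^+ n <= (x + y) ^+ (n + k).
Proof.
move=> x0 y0; rewrite exprDn.
have nnk : (n < (n + k).+1)%N by rewrite ltnS leq_addr.
rewrite (bigD1 (Ordinal nnk)) //= addKn -(mulr_natl (x ^+ k * y ^+ n)) mulrA lerDl.
by apply: sumr_ge0 => i _; rewrite mulrn_wge0 ?mulr_ge0 ?exprn_ge0.
Qed.

Lemma sum_triangle (F : nat -> nat -> R[i]) K :
  \sum_(0 <= m < K) \sum_(0 <= n < m.+1) F m n =
  \sum_(0 <= n < K) \sum_(0 <= k < K - n) F (n + k)%N n.
Proof.
elim: K => [|K IH]; first by rewrite !big_geq.
rewrite big_nat_recr //= IH.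
have -> : \sum_(0 <= n < K) \sum_(0 <= k < K - n) F (n + k)%N n =
    \sum_(0 <= n < K.+1) \sum_(0 <= k < K - n) F (n + k)%N n.
  by rewrite big_nat_recr //= subnn [X in _ + X]big_geq ?addr0.
rewrite -big_split; apply: eq_big_nat => n /andP[_ nK].
by rewrite subSn// big_nat_recr //= subnKC.
Qed.

(** Rearranging [sum_m a_m (h + w)^m] by powers of [w].  For the truncations
    this is a finite identity; the error made in the coefficient of [w^n] is a
    tail dominated by a geometric series of ratio [(|h| + s) / rho], because
    each term of the binomial expansion is at most the whole. *)
Lemma recenter a rho M (h : R[i]) s : 0 < s -> nrm h + s < rho ->
  (forall k, nrm (a k) * rho ^+ k <= M) ->
  exists b, [/\ forall n, nrm (b n) * s ^+ n <= M / (1 - (nrm h + s) / rho),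
    forall n, psums (fun k => 'C(n + k, n)%:R * a (n + k)%N) h @ \oo --> b n &
    forall w l, nrm w < s -> psums a (h + w) @ \oo --> l -> psums b w @ \oo --> l].
Proof.
move=> s0 hs aM; set q := (nrm h + s) / rho.
have h0 := nrm_ge0 h.
have rho0 : 0 < rho by lra.
have q0 : 0 <= q by rewrite divr_ge0//; lra.
have q1 : q < 1 by rewrite ltr_pdivrMr// mul1r.
have M0 : 0 <= M by have := aM 0%N; rewrite expr0 mulr1; apply: le_trans; exact: nrm_ge0.
pose u n k := 'C(n + k, n)%:R * a (n + k)%N * h ^+ k.
have uB n k : nrm (u n k) <= (M * q ^+ n / s ^+ n) * q ^+ k.
  rewrite /u !Normc.normcM nrm_nat nrmX.
  have sn : 0 < s ^+ n by rewrite exprn_gt0.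
  rewrite [leRHS]mulrAC ler_pdivlMr// -[leRHS]mulrA -exprD.
  have h1 := ler_wpM2l (nrm_ge0 (a (n + k)%N)) (binomial_term_le n k h0 (ltW s0)).
  have h2 : nrm (a (n + k)%N) <= M / rho ^+ (n + k) by rewrite ler_pdivlMr ?exprn_gt0.
  rewrite [leLHS](_ : _ = nrm (a (n + k)%N) * ('C(n + k, n)%:R * nrm h ^+ k * s ^+ n)); last by ring.
  apply: le_trans h1 _; rewrite /q expr_div_n mulrA mulrAC ler_wpM2r// exprn_ge0//; lra.
have /choice[b bP] : forall n, exists l, series (u n) @ \oo --> l /\
    forall N, nrm (series (u n) N - l) <= M * q ^+ n / s ^+ n * q ^+ N / (1 - q).
  by move=> n; have [l l1 l2] := geometric_series q0 q1 (uB n); exists l.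
exists b; split=> [n|n|w l ws al].
- have := (bP n).2 0%N; rewrite /series /= big_geq// sub0r nrmN expr0 mulr1 => hb.
  have sn : 0 < s ^+ n by rewrite exprn_gt0.
  rewrite -ler_pdivlMr//; apply: le_trans hb _.
  rewrite [leLHS]mulrAC ler_wpM2r// ?invr_ge0 ?(ltW sn)// ler_wpM2r// ?invr_ge0 ?subr_ge0 ?(ltW q1)//.
  by rewrite ler_piMr// exprn_ile1// ltW.
- exact: (bP n).1.
have w0 := nrm_ge0 w.
have p0 : 0 <= nrm w / s by rewrite divr_ge0// ltW.
have p1 : nrm w / s < 1 by rewrite ltr_pdivrMr// mul1r.
have diff K : nrm (psums a (h + w) K - psums b w K) <=
    geometric (M / (1 - q) / (1 - nrm w / s)) q K.
  have -> : psums a (h + w) K =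
      \sum_(0 <= n < K) (series (u n) (K - n)%N * w ^+ n).
    transitivity (\sum_(0 <= m < K) \sum_(0 <= n < m.+1)
        ('C(m, n)%:R * a m * h ^+ (m - n) * w ^+ n)).
      apply: eq_bigr => m _; rewrite exprDn mulr_sumr big_mkord.
      by apply: eq_bigr => i _; rewrite -mulr_natl; ring.
    rewrite sum_triangle; apply: eq_bigr => n _; rewrite /series /= mulr_suml.
    by apply: eq_bigr => k _; rewrite addKn.
  rewrite /psums [X in _ - X]/series /= -sumrB; apply: le_trans (nrm_sum _ _ _) _.
  have le1 : 0 <= M * q ^+ K / (1 - q).
    by rewrite divr_ge0 ?mulr_ge0 ?exprn_ge0 ?subr_ge0 ?(ltW q1).
  apply: (@le_trans _ _ (\sum_(0 <= n < K) M * q ^+ K / (1 - q) * (nrm w / s) ^+ n)).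
    rewrite big_nat [leRHS]big_nat; apply: ler_sum => n /andP[_ nK].
    rewrite -mulrBl Normc.normcM nrmX (expr_div_n (nrm w) s n).
    have hx := (bP n).2 (K - n)%N.
    rewrite [leRHS](_ : _ = M * q ^+ K / (1 - q) / s ^+ n * nrm w ^+ n); last by ring.
    apply: ler_wpM2r; first exact: exprn_ge0.
    apply: le_trans hx _; rewrite -[in leRHS](subnKC (ltnW nK)) exprD.
    by rewrite le_eqVlt; apply/orP; left; apply/eqP; ring.
  apply: le_trans (geometric_sum_le 0 K le1 p0 p1) _.
  by rewrite /= expr0 mulr1 le_eqVlt; apply/orP; left; apply/eqP; ring.
apply/cvgC_P => e e0; have e2 : 0 < e / 2 by rewrite divr_gt0.
have := @cvg_geometric _ (M / (1 - q) / (1 - nrm w / s)) q.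
rewrite ger0_norm// => /(_ q1) /(cvgr0Pnorm_le _) /(_ _ e2) d0.
have {}al : \forall K \near \oo, nrm (psums a (h + w) K - l) <= e / 2.
  by move/cvgC_P : al; apply.
apply: filterS2 d0 al => K h1 h2.
rewrite (_ : _ - l = (psums a (h + w) K - l) - (psums a (h + w) K - psums b w K)); last by ring.
rewrite [e]splitr; apply: le_trans (nrmB _ _) (lerD h2 _).
apply: le_trans (diff K) _; exact: le_trans (ler_norm _) h1.
Qed.

End Recentering.

(** * Taylor expansion on the whole disc *)

Section GlobalTaylor.
Context {R : realType}.
Implicit Types (a b : nat -> R[i]) (z w l h : R[i]) (r s t d rho M : R).
Implicit Types (f : R[i] -> R[i]).

Lemma discE z : disc z = (nrm z < 1) :> Prop.
Proof. by rewrite /disc /= normE -[1 in LHS](rmorph1 (real_complex R)) ltcR. Qed.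

(** Using the same number for the radius and for the bound on the coefficients
    leaves a single parameter, for which compactness yields a uniform value. *)
Definition expands_at f z d := exists a,
  (forall k, nrm (a k) * d ^+ k <= d^-1) /\
  forall w, nrm (w - z) < d -> psums a (w - z) @ \oo --> f w.

Lemma analytic_local f z : analytic_at f z -> exists a rho M,
  [/\ 0 < rho, forall k, nrm (a k) * rho ^+ k <= M &
      forall w, nrm (w - z) < rho -> psums a (w - z) @ \oo --> f w].
Proof.
move=> [a /nbhsC_P[e e0 ae]].
have e2 : 0 < e / 2 by rewrite divr_gt0.
have ne2 : nrm (z + (e / 2)%:C%C - z) = e / 2.
  by rewrite addrAC subrr add0r nrmR gtr0_norm.
have [|M HM] := @psums_coef_bound _ a (z + (e / 2)%:C%C - z) (f (z + (e / 2)%:C%C)).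
  by apply: ae; rewrite ne2; lra.
exists a, (e / 2), M; split => //; first by rewrite ne2 in HM.
by move=> w wz; apply: ae; lra.
Qed.

(** Recentring the expansion at [z0] gives expansions at all nearby points, with
    common bounds: the hypothesis of the compactness argument. *)
Lemma expands_near f z0 : analytic_at f z0 ->
  exists2 e, 0 < e & forall z d, nrm (z - z0) < e -> 0 < d -> d < e -> expands_at f z d.
Proof.
move=> /analytic_local[a [rho [M [rho0 aM af]]]].
have M0 : 0 <= M by have := aM 0%N; rewrite expr0 mulr1; apply: le_trans; exact: nrm_ge0.
have i0 : 0 < (4 * M + 1)^-1 by rewrite invr_gt0; lra.
exists (Num.min (rho / 4) (4 * M + 1)^-1).
  by rewrite lt_min i0 divr_gt0.
move=> z d; rewrite !lt_min => /andP[zz0 _] d0 /andP[drho dM].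
have s0 : 0 < rho / 2 by lra.
have hs : nrm (z - z0) + rho / 2 < rho by lra.
have [b [bB _ bl]] := recenter s0 hs aM.
exists b; split=> [k|w wz].
- apply: (@le_trans _ _ (nrm (b k) * (rho / 2) ^+ k)).
    by rewrite ler_wpM2l ?nrm_ge0// lerXn2r ?nnegrE; lra.
  apply: le_trans (bB k) _; apply: (@le_trans _ _ (4 * M)).
    rewrite mulrC ler_wpM2r// -[leRHS]invrK lef_pV2 ?posrE ?invr_gt0//; last first.
      by rewrite subr_gt0 ltr_pdivrMr// mul1r; lra.
    rewrite lerBrDr -lerBrDl ler_pdivrMr//; lra.
  apply: (@le_trans _ _ (4 * M + 1)); first lra.
  by rewrite -[leLHS]invrK lef_pV2 ?posrE// ltW.
- apply: bl; first lra.
  rewrite [z - z0 + _]addrC addrA subrK; apply: af.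
  rewrite (_ : w - z0 = (w - z) + (z - z0)); last by ring.
  by apply: le_lt_trans (nrmD _ _) _; lra.
Qed.

Lemma expands_le f z d d' : 0 < d' -> d' <= d -> expands_at f z d -> expands_at f z d'.
Proof.
move=> d'0 d'd [a [aB af]]; exists a; split=> [k|w wz]; last by apply: af; apply: lt_le_trans d'd.
apply: (@le_trans _ _ (nrm (a k) * d ^+ k)).
  by rewrite ler_wpM2l ?nrm_ge0// lerXn2r ?nnegrE; lra.
by apply: le_trans (aB k) _; rewrite lef_pV2 ?posrE//; lra.
Qed.

Lemma compact_closed_disc r : compact [set z : R[i] | nrm z <= r].
Proof.
pose g (p : R * R) : R[i] := (p.1 +i* p.2)%C.
have cg : continuous g.
  move=> p; apply/cvgC_P => e e0; have e2 : 0 < e / 2 by rewrite divr_gt0.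
  have h1 : \forall q \near p, `|p.1 - q.1| <= e / 2.
    have : (fun q : R * R => q.1) @ p --> p.1 by exact: cvg_fst.
    by move/cvgrPdist_le => /(_ _ e2).
  have h2 : \forall q \near p, `|p.2 - q.2| <= e / 2.
    have : (fun q : R * R => q.2) @ p --> p.2 by exact: cvg_snd.
    by move/cvgrPdist_le => /(_ _ e2).
  apply: filterS2 h1 h2 => q h1 h2; rewrite [e]splitr.
  apply: le_trans (nrm_le _) _; rewrite distrC in h1; rewrite distrC in h2.
  exact: lerD.
have cK : compact (g @` (`[- r, r] `*` `[- r, r])).
  apply: continuous_compact; first exact: continuous_subspaceT.
  by apply: compact_setX; exact: segment_compact.
apply: (subclosed_compact _ cK).
  rewrite -openC openE => z /= /negP; rewrite -ltNge => rz.
  apply/nbhsC_P; exists (nrm z - r); first by rewrite subr_gt0.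
  move=> w wz; apply/negP; rewrite -ltNge.
  by have := nrm_dist z w; rewrite nrm_distC; lra.
move=> z /= zr; exists (complex.Re z, complex.Im z); last by case: z zr.
have := normr_Re z; have := normr_Im z; rewrite !ler_norml => /andP[? ?] /andP[? ?].
by split; rewrite /= in_itv /=; apply/andP; split; lra.
Qed.

Lemma expands_uniform f r : r < 1 -> HD f ->
  exists2 d, 0 < d & forall z, nrm z <= r -> expands_at f z d.
Proof.
move=> r1 hf.
have /compact_near_coveringP cover := @compact_closed_disc r.
have := cover R (0^'+) (fun d z => expands_at f z d) _.
case=> [z /= zr|].
  have /hf/expands_near[e e0 he] : disc z by rewrite discE (le_lt_trans zr).
  exists ([set w | nrm (w - z) < e], [set d | 0 < d < e]) => /=; last first.
    by move=> [w d] /= [wz /andP[d0 de]]; exact: he.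
  split; first by apply/nbhsC_P; exists e.
  near=> d; apply/andP; split; near: d; [exact: nbhs_right_gt|exact: nbhs_right_lt].
move=> /= e e0 he; exists (e / 2); first by rewrite divr_gt0.
move=> z zr; apply: he => //=; last by rewrite divr_gt0.
by rewrite sub0r normrN gtr0_norm ?divr_gt0//; rewrite /= in e0; lra.
Unshelve. all: by end_near. Qed.

Lemma linear_geometric_bound (q : R) m : 0 <= q -> q < 1 -> m.+1%:R * q ^+ m <= (1 - q)^-1.
Proof.
move=> q0 q1; have := geometric_sum_le 0 m.+1 (@ler01 R) q0 q1.
rewrite expr0 mul1r mul1r; apply: le_trans.
rewrite mulr_natl -[X in _ *+ X](subn0 m.+1) -sumr_const_nat.
rewrite big_nat [leRHS]big_nat; apply: ler_sum => i /andP[_ im].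
by rewrite mul1r ler_wiXn2l// ltW.
Qed.

(** Inside the disc of radius [r], the [n]-th Taylor coefficient of [f] at [h] is
    [sum_k C(n+k,n) a_(n+k) h^k], and it is at most [d^-(n+1)] by the uniform
    expansions.  Cauchy's inequality for this series in [h], at the radius
    [r - d/2], bounds each term of the binomial expansion of
    [|a_m| ((r - d/2) + d)^m], hence [|a_m| (r + d/2)^m <= (m + 1) / d]. *)
Lemma coef_extend f a r d : 0 < d -> d <= r ->
  (forall z, nrm z < r -> psums a z @ \oo --> f z) ->
  (forall z, nrm z <= r -> expands_at f z d) ->
  exists M, forall k, nrm (a k) * (r + d / 4) ^+ k <= M.
Proof.
move=> d0 dr af fd.
have n6 : nrm (r - d / 6)%:C%C = r - d / 6 by rewrite nrmR gtr0_norm; lra.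
have [|M6] := @psums_coef_bound _ a (r - d / 6)%:C%C (f (r - d / 6)%:C%C).
  by apply: af; rewrite n6; lra.
rewrite n6 => aM.
pose c n k := 'C(n + k, n)%:R * a (n + k)%N.
have val h n : nrm h <= r - d / 3 ->
    exists l, psums (c n) h @ \oo --> l /\ nrm l * d ^+ n <= d^-1.
  move=> hr; have s0 : 0 < d / 12 by lra.
  have hs : nrm h + d / 12 < r - d / 6 by lra.
  have [b [_ bl bw]] := recenter s0 hs aM.
  exists (b n); split; first exact: bl.
  have [|e [eB ew]] := fd h; first lra.
  suff -> : b = e by [].
  apply: (@psums_unique _ b e (d / 12) (fun w => f (h + w))) => // w wd.
    by apply: bw => //; apply: af; apply: le_lt_trans (nrmD _ _) _; lra.
  have hw : h + w - h = w by rewrite addrAC subrr add0r.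
  by rewrite -{1}hw; apply: ew; rewrite hw; lra.
have cB n k : nrm (c n k) * (r - d / 2) ^+ k * d ^+ n <= d^-1.
  have n3 : nrm (r - d / 3)%:C%C = r - d / 3 by rewrite nrmR gtr0_norm; lra.
  have [|l3 [l3l _]] := val (r - d / 3)%:C%C n; first by rewrite n3.
  have [M3] := psums_coef_bound l3l; rewrite n3 => cM.
  have dn : 0 < d ^+ n by rewrite exprn_gt0.
  rewrite -ler_pdivlMr//.
  pose F h := limn (psums (c n) h).
  have FE h l : psums (c n) h @ \oo --> l -> F h = l.
    exact: limC_eq.
  apply: (@cauchy_sup _ (c n) (r - d / 3) M3 (r - d / 2) k F); [lra|lra|exact: cM| |].
    move=> z zr; have [|l [ll _]] := val z n; first lra.
    by rewrite (FE _ _ ll).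
  move=> z zr; have [|l [ll lB]] := val z n; first lra.
  by rewrite (FE _ _ ll) ler_pdivlMr.
have aB m : nrm (a m) * (r + d / 2) ^+ m <= m.+1%:R / d.
  rewrite (_ : r + d / 2 = (r - d / 2) + d); last by lra.
  rewrite exprDn mulr_sumr.
  apply: (@le_trans _ _ (\sum_(i < m.+1) d^-1)); last first.
    by rewrite sumr_const card_ord mulr_natl.
  apply: ler_sum => i _; have im : (i <= m)%N by rewrite -ltnS.
  have := cB i (m - i)%N; rewrite /c subnKC// Normc.normcM nrm_nat; apply: le_trans.
  by rewrite -mulr_natl le_eqVlt; apply/orP; left; apply/eqP; ring.
pose q := (r + d / 4) / (r + d / 2).
have rd : 0 < r + d / 2 by lra.
have q0 : 0 <= q by rewrite divr_ge0//; lra.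
have q1 : q < 1 by rewrite ltr_pdivrMr// mul1r; lra.
exists ((1 - q)^-1 / d) => k.
rewrite (_ : r + d / 4 = (r + d / 2) * q); last by rewrite /q mulrCA divff ?mulr1// gt_eqF.
rewrite exprMn mulrA; apply: (@le_trans _ _ (k.+1%:R / d * q ^+ k)).
  by rewrite ler_wpM2r ?exprn_ge0.
by rewrite mulrAC ler_wpM2r ?invr_ge0 ?(ltW d0)// linear_geometric_bound.
Qed.

(** A point [w] slightly outside the disc of radius [r] is compared with the
    point [z] of modulus [r - d/8] on the same ray.  At [z] both [f] and the sum
    of the series have expansions reaching [w]; they agree near [z], so they
    have the same coefficients. *)
Lemma sum_extend f a r d : 0 < d -> d <= r ->
  (forall z, nrm z < r -> psums a z @ \oo --> f z) ->
  (forall z, nrm z <= r -> expands_at f z d) ->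
  forall z, nrm z < r + d / 8 -> psums a z @ \oo --> f z.
Proof.
move=> d0 dr af fd w wr; have [/af//|rw] := ltP (nrm w) r.
have [M aM] := coef_extend d0 dr af fd.
have nw0 : 0 < nrm w by lra.
pose x := (r - d / 8) / nrm w; pose z := w * x%:C%C.
have x0 : 0 <= x by rewrite divr_ge0//; lra.
have x1 : x <= 1 by rewrite ler_pdivrMr//; lra.
have xw : nrm w * x = r - d / 8 by rewrite /x mulrCA divff ?mulr1// gt_eqF.
have nz : nrm z = r - d / 8 by rewrite Normc.normcM nrmR ger0_norm.
have nwz : nrm (w - z) = nrm w - (r - d / 8).
  rewrite /z (_ : w - _ = w * (1 - x)%:C%C); last by rewrite rmorphB rmorph1; ring.
  by rewrite Normc.normcM nrmR ger0_norm ?subr_ge0// mulrBr mulr1 xw.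
have s0 : 0 < d / 4 by lra.
have hs : nrm z + d / 4 < r + d / 4 by lra.
have [b [_ _ bw]] := recenter s0 hs aM.
have [|c [_ cw]] := fd z; first lra.
have bc : b = c.
  have d8 : 0 < d / 8 by lra.
  apply: (@psums_unique _ b c (d / 8) (fun v => f (z + v))) => // v vd.
    by apply: bw; [lra|apply: af; apply: le_lt_trans (nrmD _ _) _; lra].
  have hv : z + v - z = v by rewrite addrAC subrr add0r.
  by rewrite -{1}hv; apply: cw; rewrite hv; lra.
have rd : 0 < r + d / 4 by lra.
have [|l al _] := psums_cvg rd _ aM (z := w); first lra.
suff -> : f w = l by [].
apply: (@cvgC_unique _ (psums b (w - z))).
  by rewrite bc; apply: cw; lra.
by apply: bw; [lra|rewrite addrCA subrr addr0].
Qed.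

(** The supremum of the radii up to which the expansion at [0] represents [f] is
    [1]: if it were smaller, [sum_extend] would exceed it. *)
Theorem global_taylor f : HD f ->
  exists a, forall z, nrm z < 1 -> psums a z @ \oo --> f z.
Proof.
move=> hf; have /hf/analytic_local[a [rho [M [rho0 _ af0]]]] : disc (0 : R[i]).
  by rewrite discE Normc.normc0.
exists a.
pose S := [set r | 0 < r <= 1 /\ forall z, nrm z < r -> psums a z @ \oo --> f z].
have Srho : S (Num.min rho 1).
  split; first by rewrite lt_min rho0 ltr01 ge_min lexx orbT.
  by move=> z; rewrite lt_min => /andP[zr _]; have := af0 z; rewrite subr0; exact.
have Sub : has_sup S.
  by split; [exists (Num.min rho 1)|exists 1 => r [/andP[]]].
have Sle r : S r -> r <= sup S by move=> Sr; apply: ub_le_sup => //; exact: Sub.2.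
have Ssup z : nrm z < sup S -> psums a z @ \oo --> f z.
  move=> zS; have e0 : 0 < sup S - nrm z by rewrite subr_gt0.
  have [r [_ Sr]] := sup_adherent e0 Sub.
  by rewrite opprB addrC subrK => zr; exact: Sr.
have S0 : 0 < sup S.
  by apply: lt_le_trans (Sle _ Srho); rewrite lt_min rho0 ltr01.
have [S1|S1] := leP 1 (sup S); first by move=> z z1; apply: Ssup; apply: lt_le_trans S1.
exfalso.
have [d d0 fd] := expands_uniform S1 hf.
pose e := Num.min d (sup S).
have e0 : 0 < e by rewrite lt_min d0 S0.
have eS : e <= sup S by rewrite ge_min lexx orbT.
have fe z : nrm z <= sup S -> expands_at f z e.
  by move=> zS; apply: expands_le (fd z zS) => //; rewrite ge_min lexx.
have ext := sum_extend e0 eS Ssup fe.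
have : Num.min (sup S + e / 8) 1 <= sup S.
  apply: Sle; split; last by move=> z; rewrite lt_min => /andP[+ _]; exact: ext.
  by rewrite lt_min ltr01 ge_min lexx orbT !andbT; lra.
by rewrite ge_min => /orP[]; lra.
Qed.

End GlobalTaylor.

(** * Iterates of the shift and the topology of H(D) *)

Section DiscSums.
Context {R : realType}.
Implicit Types (a b : nat -> R[i]) (z w l h : R[i]) (r s t d rho M alpha : R).
Implicit Types (f g : R[i] -> R[i]).

Definition disc_sum a f := forall z, nrm z < 1 -> psums a z @ \oo --> f z.

Lemma disc_sum_coef_bound a f r : disc_sum a f -> 0 <= r -> r < 1 ->
  exists M, forall k, nrm (a k) * r ^+ k <= M.
Proof.
move=> af r0 r1; have nr : nrm r%:C%C = r by rewrite nrmR ger0_norm.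
have [|M] := @psums_coef_bound _ a r%:C%C (f r%:C%C); first by apply: af; rewrite nr.
by rewrite nr => HM; exists M.
Qed.

Lemma disc_sum_HD a f : disc_sum a f -> HD f.
Proof.
move=> af z0; rewrite discE => z01.
pose s := (1 - nrm z0) / 3; have s0 : 0 < s by rewrite divr_gt0 ?subr_gt0.
have sE : 3 * s = 1 - nrm z0 by rewrite /s; field.
have r0 : 0 <= nrm z0 + 2 * s by have := nrm_ge0 z0; lra.
have r1 : nrm z0 + 2 * s < 1 by lra.
have hs : nrm z0 + s < nrm z0 + 2 * s by lra.
have [M aM] := disc_sum_coef_bound af r0 r1.
have [b [_ _ bw]] := recenter s0 hs aM.
exists b; apply/nbhsC_P; exists s => // w wz; apply: bw => //.
rewrite addrC subrK; apply: af.
by have := nrm_dist w z0; lra.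
Qed.

Lemma taylorE a f : disc_sum a f -> taylor f = a.
Proof.
move=> af; rewrite /taylor.
set A := [set b | _].
have Aa : A a by move=> z; rewrite discE; exact: af.
have Ag : A (get A) by apply: getPex; exists a.
apply: (@psums_unique _ (get A) a 1 f) => //.
by move=> z z1; apply: Ag; rewrite discE.
Qed.

Lemma weight_ge0 alpha n : 0 <= weight alpha n.
Proof. exact: powR_ge0. Qed.

Lemma weight_le alpha n : weight alpha n.+1 <= 2 `^ `|alpha|.
Proof.
rewrite /weight; set x : R := 1 + _.
have i0 : 0 <= n.+1%:R^-1 :> R by rewrite invr_ge0.
have i1 : n.+1%:R^-1 <= 1 :> R by rewrite invf_le1 ?ltr0n// ler1n.
apply: (@le_trans _ _ (x `^ `|alpha|)).
  by apply: ler_powR; [rewrite /x lerDl|exact: ler_norm].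
by apply: ge0_ler_powR; rewrite ?nnegrE ?normr_ge0 ?addr_ge0// /x [leRHS](_ : 2 = 1 + 1)// lerD2l.
Qed.

Lemma disc_sum_shift alpha a f : disc_sum a f ->
  disc_sum (fun k => a k.+1 * (weight alpha k.+1)%:C%C) (taylor_shift alpha f).
Proof.
move=> af z z1; rewrite /taylor_shift (taylorE af).
set b := fun k => _.
pose r := (1 + nrm z) / 2.
have n0 := nrm_ge0 z.
have r0 : 0 < r by rewrite /r; lra.
have r1 : r < 1 by rewrite /r; lra.
have zr : nrm z < r by rewrite /r; lra.
have [M aM] := disc_sum_coef_bound af (ltW r0) r1.
have bM k : nrm (b k) * r ^+ k <= M / r * 2 `^ `|alpha|.
  rewrite /b Normc.normcM nrmR ger0_norm ?weight_ge0// mulrAC.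
  apply: ler_pM; [|exact: weight_ge0| |exact: weight_le].
    by rewrite mulr_ge0 ?nrm_ge0// exprn_ge0// ltW.
  by rewrite ler_pdivlMr// -mulrA -exprSr.
have [l bl _] := psums_cvg r0 zr bM.
by rewrite (_ : limn _ = l)//; apply: limC_eq.
Qed.

(** For [k <= m] this is the product of the weights of indices [k + 1] to [m];
    for [k > m] it is the inverse of such a product, which is what placing a
    block at higher degrees requires. *)
Definition weight_ratio alpha m k : R := (m.+1%:R / k.+1%:R) `^ alpha.

Lemma disc_sum_iter alpha a f n : disc_sum a f ->
  disc_sum (fun k => a (k + n)%N * (weight_ratio alpha (k + n) k)%:C%C)
           (iter n (taylor_shift alpha) f).
Proof.
move=> af; elim: n => [|n IH].
  rewrite (_ : (fun k => _) = a)//; apply/funext => k.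
  by rewrite addn0 /weight_ratio divff ?pnatr_eq0// powR1 mulr1.
have := @disc_sum_shift alpha _ _ IH; congr disc_sum; apply/funext => k.
rewrite addSnnS -mulrA -rmorphM; congr (_ * _%:C%C).
have k0 : 0 <= k.+1%:R^-1 :> R by rewrite invr_ge0 ler0n.
rewrite /weight_ratio /weight -powRM ?addr_ge0 ?divr_ge0 ?ler0n//.
congr (_ `^ _); have -> : 1 + k.+1%:R^-1 = k.+2%:R / k.+1%:R :> R.
  by rewrite -[k.+2%:R]natr1 mulrDl divff ?mul1r ?pnatr_eq0// addrC.
by rewrite mulrA divfK ?pnatr_eq0.
Qed.

Lemma disc_sum0 a f : disc_sum a f -> f 0 = a 0%N.
Proof.
move=> /(_ 0); rewrite Normc.normc0 => /(_ ltr01) h.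
apply: (cvgC_unique h); apply/cvgC_P => e e0; exists 1%N => // n /= n1.
rewrite /psums /series /= -(prednK n1) big_nat_recl//= expr0 mulr1.
rewrite big1 ?addr0 ?subrr ?Normc.normc0 ?ltW// => i _.
by rewrite expr0n mulr0.
Qed.

Lemma entourageC_P (E : set (R[i] * R[i])) : entourage E <->
  exists2 e, 0 < e & forall z w, nrm (z - w) < e -> E (z, w).
Proof.
rewrite -entourage_ballE; split=> [[e /= e0 eE]|[e e0 eE]].
  have er : e = (complex.Re e)%:C%C by rewrite RRe_real// gtr0_real.
  exists (complex.Re e); first by rewrite -ltcR -er.
  by move=> z w zw; apply: eE; rewrite /= /ball /= normE er ltcR.
exists e%:C%C; first by rewrite /= ltcR.
by move=> [z w]; rewrite /= /ball /= normE ltcR; exact: eE.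
Qed.

Lemma compact_in_disc (K : set R[i]) : compact K -> K `<=` disc ->
  exists2 r, r < 1 & forall z, K z -> nrm z <= r.
Proof.
move=> /compact_near_coveringP cover Kd.
have cov : \forall r \near 1^'-, K `<=` [set z | nrm z <= r].
  apply: (cover R (1^'-) (fun r z => nrm z <= r)) => z /Kd; rewrite discE => z1.
  pose e := (1 - nrm z) / 2; have e0 : 0 < e by rewrite divr_gt0 ?subr_gt0.
  exists ([set w | nrm (w - z) < e], [set r | 1 - e < r]) => /=; last first.
    by move=> [w r] /= [wz er]; have := nrm_dist w z; rewrite /e in wz er *; lra.
  split; first by apply/nbhsC_P; exists e.
  by apply: nbhs_left_gt; rewrite ltrBlDr ltrDl.
have [r [rK r1]] : exists r, K `<=` [set z | nrm z <= r] /\ r < 1.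
  apply: (@filter_ex _ (1^'-)); near=> r; split; first by near: r.
  by near: r; exact: nbhs_left_lt.
by exists r.
Unshelve. all: by end_near. Qed.

(** Uniform convergence on the closed discs of radius [r < 1] is convergence in
    [H(D)], since every compact subset of the disc lies in one of them. *)
Lemma HD_open_eventually (U : set (R[i] -> R[i])) g (h : nat -> R[i] -> R[i]) :
  HD_open U -> U g -> (forall n, HD (h n)) ->
  (forall r e, r < 1 -> 0 < e ->
     \forall n \near \oo, forall z, nrm z <= r -> nrm (h n z - g z) < e) ->
  \forall n \near \oo, U (h n).
Proof.
move=> [V oV ->] [Vg _] Hh hg.
have : {family compactly_in disc, h @ \oo --> g}.
  apply/fam_cvgP => K [Kd cK] P /uniform_nbhs[E [/entourageC_P[e e0 eE] EP]].
  have [r r1 rK] := compact_in_disc cK Kd.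
  apply: filterS (hg r e r1 e0) => n hn; apply: EP => z Kz /=.
  by apply: eE; rewrite nrm_distC; apply/hn/rK.
have nV : nbhs (g : {family compactly_in disc, R[i] -> R[i]}) V.
  by rewrite nbhsE; exists V.
move=> /(_ V nV) hV; have {}hV : \forall n \near \oo, V (h n) by exact: hV.
by apply: filterS hV => n Vn; split; last exact: Hh.
Qed.

Lemma HD_open_large_at0 M : HD_open [set g | M < nrm (g 0) /\ HD g].
Proof.
exists [set g : {family compactly_in disc, R[i] -> R[i]} | M < nrm (g 0)] => //.
rewrite openE => g /= Mg.
have K0 : compactly_in disc [set (0 : R[i])].
  split; last exact: compact_set1.
  by move=> z /= ->; rewrite discE Normc.normc0.
have := (@fam_cvgP _ _ (compactly_in disc)
  (nbhs (g : {family compactly_in disc, R[i] -> R[i]})) g _).1 cvg_id _ K0.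
apply; apply/uniform_nbhs.
exists [set p | nrm (p.1 - p.2) < nrm (g 0) - M]; split.
  by apply/entourageC_P; exists (nrm (g 0) - M); rewrite // subr_gt0.
move=> h /= /(_ 0 erefl) gh.
by have := nrm_dist (g 0) (h 0); lra.
Qed.

(** The value at [0] of the [n]-th iterate is [a_n (n + 1)^alpha], and
    evaluation at [0] is continuous. *)
Lemma hypercyclic_unbounded alpha a f M : hypercyclic alpha f -> disc_sum a f ->
  exists n, M < nrm (a n) * n.+1%:R `^ alpha.
Proof.
move=> [_ hf] af; pose c := Num.max M 0 + 1.
have c0 : 0 < c by rewrite /c ltr_wpDl// le_max lexx orbT.
have [|n Un] := infinite_setN0 (hf _ (HD_open_large_at0 M) _).
  exists (fun=> c%:C%C); split.
    by rewrite nrmR gtr0_norm// /c ltr_pwDr// le_max lexx.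
  apply: (@disc_sum_HD (fun k => if k == 0%N then c%:C%C else 0)) => z _.
  apply/cvgC_P => e e0; exists 1%N => // m /= m1.
  rewrite /psums /series /= -(prednK m1) big_nat_recl//= expr0 mulr1.
  rewrite big1 ?addr0 ?subrr ?Normc.normc0 ?ltW// => i _.
  by rewrite mul0r.
move: Un => /= [+ _]; rewrite (disc_sum0 (@disc_sum_iter alpha _ _ n af)) add0n.
rewrite Normc.normcM nrmR /weight_ratio divr1 ger0_norm ?powR_ge0// => Mn.
by exists n.
Qed.

End DiscSums.

(** * Integral means and the negative statements *)

Section IntegralMeans.
Context {R : realType}.
Implicit Types (a b : nat -> R[i]) (z w l : R[i]) (r s t x M B alpha : R).
Implicit Types (f g : R[i] -> R[i]) (p : \bar R).

Local Notation I02 := `[0, 2 * pi]%classic.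

Lemma le_circle_int_in (h g : R -> R) :
  lebesgue_measure.-integrable I02 (EFin \o h) ->
  lebesgue_measure.-integrable I02 (EFin \o g) ->
  (forall t, t \in `[0, 2 * pi] -> h t <= g t) -> circle_int h <= circle_int g.
Proof. by move=> ch cg hg; apply: le_Rintegral => // t; exact: hg. Qed.

Lemma disc_sum_circle a f r : 0 <= r -> r < 1 -> disc_sum a f ->
  continuous (fun t => nrm (f (circle_pt r t))) /\
  exists B, forall z, nrm z = r -> nrm (f z) <= B.
Proof.
move=> r0 r1 af; pose s := (1 + r) / 2.
have rs : r < s by rewrite /s; lra.
have s1 : s < 1 by rewrite /s; lra.
have s0 : 0 < s by lra.
have [M aM] := disc_sum_coef_bound af (ltW s0) s1.
split.
  by apply: (continuous_nrm_circle r0 rs aM) => z zr; apply: af; rewrite zr.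
exists (M / (1 - r / s)) => z zr.
have [|l al lB] := psums_cvg s0 _ aM (z := z); first by rewrite zr.
have z1 : nrm z < 1 by rewrite zr.
rewrite (cvgC_unique (af z z1) al).
have := lB 0%N; rewrite /psums /series /= big_geq// sub0r nrmN expr0 mulr1.
by rewrite zr.
Qed.

Lemma measurable_circle_integrable (h : R -> R) (B : R) :
  measurable_fun setT h -> (forall t, `|h t| <= B) ->
  lebesgue_measure.-integrable I02 (EFin \o h).
Proof.
move=> mh hB; apply: measurable_bounded_integrable => //.
- by rewrite /= lebesgue_measure_itv /= lte_fin twopi_gt0 -EFinB ltry.
- exact: measurable_funTS mh.
exists B; split; first by rewrite num_real.
by move=> M BM t _ /=; apply: le_trans (ltW BM).
Qed.

Lemma circle_integrable_powR (h : R -> R) (q B c d : R) : 0 <= q -> continuous h ->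
  (forall t, 0 <= h t <= B) ->
  lebesgue_measure.-integrable I02 (EFin \o (fun t => c * h t `^ q + d)).
Proof.
move=> q0 ch hB.
apply: (@measurable_circle_integrable _ (`|c| * B `^ q + `|d|)).
  apply: measurable_funD; last exact: measurable_cst.
  apply: measurable_funM; first exact: measurable_cst.
  exact: (measurableT_comp (@measurable_powR R q) (continuous_measurable_fun ch)).
move=> t; apply: le_trans (ler_normD _ _) _; rewrite lerD2r normrM ler_wpM2l//.
rewrite ger0_norm ?powR_ge0//; have /andP[h0 h1] := hB t.
by apply: ge0_ler_powR; rewrite ?nnegrE// (le_trans h0).
Qed.

(** Jensen's inequality for [x |-> x^q], through Young's inequality applied to
    [h t] and the constant [m^(q-1)], [m] being the mean of [h]. *)
Lemma power_mean (h : R -> R) (q B : R) : 1 <= q -> continuous h ->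
  (forall t, 0 <= h t <= B) ->
  (2 * pi)^-1 * circle_int h <= ((2 * pi)^-1 * circle_int (fun t => h t `^ q)) `^ q^-1.
Proof.
move=> q1 ch hB; set m := _ * circle_int h.
have p0 := @twopi_gt0 R.
have ip0 : 0 < (2 * pi)^-1 :> R by rewrite invr_gt0.
have m0 : 0 <= m.
  by rewrite mulr_ge0 ?(ltW ip0)//; apply: Rintegral_ge0 => t _; case/andP: (hB t).
have q0 : 0 < q by lra.
have ihq c d := circle_integrable_powR c d (ltW q0) ch hB.
set A := _ * circle_int _.
suff mA : m `^ q <= A.
  rewrite -[m](powRr1 m0) -(divff (lt0r_neq0 q0)) powRrM.
  by apply: ge0_ler_powR; rewrite ?nnegrE ?invr_ge0 ?(ltW q0)// ?powR_ge0// (le_trans _ mA)// powR_ge0.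
have [q1'|qn1] := eqVneq q 1.
  rewrite /A q1' powRr1// /m le_eqVlt; apply/orP; left; apply/eqP; congr (_ * _).
  by apply: eq_Rintegral => t _; rewrite powRr1//; case/andP: (hB t).
have {qn1}q1 : 1 < q by rewrite lt_def qn1.
pose q' := q / (q - 1).
have qq0 : 0 < q - 1 by lra.
have q'0 : 0 < q' by rewrite divr_gt0.
have qq' : q^-1 + q'^-1 = 1 by rewrite /q' invf_div; field; lra.
have cE : (m `^ (q - 1)) `^ q' = m `^ q by rewrite -powRrM /q' mulrCA divff ?mulr1// gt_eqF.
have key : circle_int (fun t => m `^ (q - 1) * h t) <=
   circle_int (fun t => q^-1 * h t `^ q + m `^ q / q').
  apply: le_circle_int_in.
  - by apply: circle_integrable => t; apply: cvgM; [exact: cvg_cst|exact: ch].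
  - exact: ihq.
  move=> t _; have /andP[h0 _] := hB t.
  have := conjugate_powR h0 (powR_ge0 m (q - 1)) q0 q'0 qq'.
  by rewrite cE mulrC [in leRHS]mulrC.
have int1 : circle_int (fun t => m `^ (q - 1) * h t) = 2 * pi * m `^ q.
  rewrite circle_intZ// -(mulr_powRB1 m0 q0) /m; set I := circle_int h.
  by rewrite [RHS]mulrA [2 * pi * _]mulrA divff ?mul1r ?gt_eqF// mulrC.
have int2 : circle_int (fun t => q^-1 * h t `^ q + m `^ q / q') =
    q^-1 * circle_int (fun t => h t `^ q) + 2 * pi * (m `^ q / q').
  have i1 : lebesgue_measure.-integrable I02 (EFin \o (fun t => h t `^ q)).
    rewrite (_ : (fun t => _) = fun t => 1 * h t `^ q + 0); first exact: ihq.
    by apply/funext => t; rewrite mul1r addr0.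
  have i2 : lebesgue_measure.-integrable I02 (EFin \o (fun t => q^-1 * h t `^ q)).
    rewrite (_ : (fun t => _) = fun t => q^-1 * h t `^ q + 0); first exact: ihq.
    by apply/funext => t; rewrite addr0.
  rewrite /circle_int RintegralD//.
  - by congr (_ + _); [exact: RintegralZl|exact: circle_int_cst].
  - by apply: circle_integrable => t; exact: cvg_cst.
have AE : circle_int (fun t => h t `^ q) = 2 * pi * A.
  by rewrite /A mulrA divff ?mul1r ?gt_eqF.
rewrite int1 int2 AE in key.
have {}key : m `^ q <= q^-1 * A + m `^ q / q'.
  rewrite -(ler_pM2l p0); apply: le_trans key _.
  by rewrite le_eqVlt; apply/orP; left; apply/eqP; ring.
have iq' : q'^-1 = 1 - q^-1 by apply/esym/eqP; rewrite subr_eq [X in _ == X]addrC qq'.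
have {}key : 0 <= q^-1 * (A - m `^ q).
  by rewrite mulrBr; move: key; rewrite iq' mulrBr mulr1 [_ / q]mulrC; lra.
by move: key; rewrite pmulr_rge0 ?invr_gt0// subr_ge0.
Qed.

Lemma coef_le_Mp p a f r n : (1 <= p)%E -> 0 < r -> r < 1 -> disc_sum a f ->
  nrm (a n) * r ^+ n <= Mp p f r.
Proof.
move=> p1 r0 r1 af; have [ch [B hB]] := disc_sum_circle (ltW r0) r1 af.
have p0 := @twopi_gt0 R.
have hB' t : 0 <= nrm (f (circle_pt r t)) <= B.
  by rewrite nrm_ge0 hB// nrm_circle_pt// ltW.
have aI : nrm (a n) * r ^+ n <= (2 * pi)^-1 * circle_int (fun t => nrm (f (circle_pt r t))).
  rewrite ler_pdivlMl//; pose s := (1 + r) / 2.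
  have rs : r < s by rewrite /s; lra.
  have s1 : s < 1 by rewrite /s; lra.
  have s0 : 0 <= s by lra.
  have [M aM] := disc_sum_coef_bound af s0 s1.
  by apply: (cauchy_mean _ (ltW r0) rs aM) => z zr; apply: af; rewrite zr.
apply: le_trans aI _; case: p p1 => [q||] //= q1.
  by rewrite lee_fin in q1; exact: power_mean hB'.
set S := [set _ | _ in _].
rewrite ler_pdivrMl// -circle_int_cst; apply: le_circle_int_in.
- exact: circle_integrable.
- by apply: circle_integrable => t; exact: cvg_cst.
move=> t t02; apply: ub_le_sup; last by exists t.
by exists B => _ [u _ <-]; case/andP: (hB' u).
Qed.

Lemma Mp_le p a f r B : (1 <= p)%E -> 0 < r -> r < 1 -> disc_sum a f ->
  (forall z, nrm z = r -> nrm (f z) <= B) -> Mp p f r <= B.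
Proof.
move=> p1 r0 r1 af hB; have [ch _] := disc_sum_circle (ltW r0) r1 af.
have p0 := @twopi_gt0 R.
have hB' t : 0 <= nrm (f (circle_pt r t)) <= B.
  by rewrite nrm_ge0 hB// nrm_circle_pt// ltW.
have B0 : 0 <= B by have /andP[h0 h1] := hB' 0; apply: le_trans h1.
case: p p1 => [q||] //= q1; last first.
  apply: ge_sup; last by move=> _ [u _ <-]; case/andP: (hB' u).
  by exists (nrm (f (circle_pt r 0))), 0 => //=; rewrite in_itv /= lexx ltW.
rewrite lee_fin in q1; have q0 : 0 < q by lra.
have -> : B = (B `^ q) `^ q^-1 by rewrite -powRrM divff ?powRr1// gt_eqF.
have i0 : 0 <= (2 * pi)^-1 :> R by rewrite invr_ge0 ltW.
apply: ge0_ler_powR; rewrite ?nnegrE ?invr_ge0 ?(ltW q0) ?powR_ge0//.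
  by rewrite mulr_ge0//; apply: Rintegral_ge0 => t _; exact: powR_ge0.
rewrite ler_pdivrMl// -circle_int_cst; apply: le_circle_int_in.
- set h := (X in EFin \o X); rewrite (_ : h = fun t => 1 * nrm (f (circle_pt r t)) `^ q + 0).
    exact: circle_integrable_powR (ltW q0) ch hB'.
  by apply/funext => t; rewrite mul1r addr0.
- by apply: circle_integrable => t; exact: cvg_cst.
move=> t _; have /andP[h0 h1] := hB' t.
by apply: ge0_ler_powR; rewrite ?nnegrE// ltW.
Qed.

Lemma HD_disc_sum f : HD f -> disc_sum (taylor f) f.
Proof. by move=> /global_taylor[a af]; rewrite (taylorE af). Qed.

Lemma bernoulli_ineq (x : R) n : 0 <= x -> x <= 1 -> 1 - n%:R * x <= (1 - x) ^+ n.
Proof.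
move=> x0 x1; elim: n => [|n IH]; first by rewrite expr0 mul0r subr0.
rewrite exprS; apply: (@le_trans _ _ ((1 - x) * (1 - n%:R * x))); last first.
  by rewrite ler_wpM2l// subr_ge0.
rewrite -natr1 -subr_ge0; have -> : (1 - x) * (1 - n%:R * x) - (1 - (n%:R + 1) * x) = n%:R * x ^+ 2.
  by ring.
by rewrite mulr_ge0 ?sqr_ge0.
Qed.

(** Cauchy's inequality at the radius [1 - x], [x = 1/(2(n+1))], where
    Bernoulli's inequality keeps [(1 - x)^n] above [1/2], bounds
    [|a_n| (n+1)^alpha] by a constant, against [hypercyclic_unbounded]. *)
Lemma no_slow_growth p alpha f (C : R) : (1 <= p)%E -> 0 < C -> hypercyclic alpha f ->
  ~ forall r, 0 < r < 1 -> Mp p f r <= C * (1 - r) `^ alpha.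
Proof.
move=> p1 C0 hf bound.
have af := HD_disc_sum hf.1.
have [n] := @hypercyclic_unbounded _ alpha _ f (2 * C * (2 `^ (- alpha))) hf af.
apply/negP; rewrite -leNgt.
have n0 : 0 < n.+1%:R :> R by rewrite ltr0n.
pose x : R := (2 * n.+1%:R)^-1.
have x0 : 0 < x by rewrite invr_gt0 mulr_gt0.
have x2 : n%:R * x <= 2^-1.
  rewrite /x invfM mulrCA ler_piMr// ler_pdivrMr// mul1r ler_nat; lia.
have x1 : x <= 2^-1.
  by rewrite /x invfM ler_piMr// invf_le1// ler1n.
have r0 : 0 < 1 - x by lra.
have r1 : 1 - x < 1 by lra.
have h1 : nrm (taylor f n) * (1 - x) ^+ n <= C * x `^ alpha.
  apply: le_trans (coef_le_Mp n p1 r0 r1 af) _.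
  by have := bound (1 - x); rewrite r0 r1 subKr; apply.
have h2 : 2^-1 <= (1 - x) ^+ n.
  by apply: le_trans (bernoulli_ineq n (ltW x0) _); lra.
have h3 : nrm (taylor f n) <= 2 * (C * x `^ alpha).
  rewrite -ler_pdivrMl//; apply: le_trans h1.
  by rewrite mulrC ler_wpM2l ?nrm_ge0.
have xE : x `^ alpha * n.+1%:R `^ alpha = 2 `^ (- alpha).
  rewrite -powRM ?(ltW x0) ?(ltW n0)// /x invfM mulfVK ?gt_eqF//.
  by rewrite -(powR_inv1 (ler0n R 2)) -powRrM mulN1r.
rewrite -mulrA -xE mulrA; apply: le_trans (ler_wpM2r (powR_ge0 _ _) h3) _.
by rewrite le_eqVlt; apply/orP; left; apply/eqP; ring.
Qed.

(** Cauchy's inequality leaves [a_n = 0] as [r] tends to [1]. *)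
Lemma no_decay p alpha f (phi : R -> R) : (1 <= p)%E -> hypercyclic alpha f ->
  phi r @[r --> 1^'-] --> 0 -> ~ forall r, 0 < r < 1 -> Mp p f r <= phi r.
Proof.
move=> p1 hf phi0 bound.
have af := HD_disc_sum hf.1.
have [n] := @hypercyclic_unbounded _ alpha _ f 0 hf af.
apply/negP; rewrite -leNgt.
suff : nrm (taylor f n) <= 0 by move=> h; rewrite mulr_le0_ge0// powR_ge0.
have h2n : 0 < 2 ^+ n :> R by rewrite exprn_gt0.
apply/ler_addgt0Pr => e e0; rewrite add0r.
have e' : 0 < e / 2 ^+ n by rewrite divr_gt0.
move/(cvgr0Pnorm_le _) : phi0 => /(_ _ e') phie.
have [r [re r2 r1]] : exists r, [/\ `|phi r| <= e / 2 ^+ n, 2^-1 < r & r < 1].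
  apply: (@filter_ex _ (1^'-)); near=> r; split; near: r => //.
    by apply: nbhs_left_gt; lra.
  exact: nbhs_left_lt.
have r0 : 0 < r by lra.
have h1 : nrm (taylor f n) * r ^+ n <= e / 2 ^+ n.
  apply: le_trans (coef_le_Mp n p1 r0 r1 af) _.
  by apply: le_trans (bound r _) _; rewrite ?r0 ?r1//; apply: le_trans (ler_norm _) re.
rewrite ler_pdivlMr// in h1; apply: le_trans h1.
rewrite -mulrA -exprMn ler_peMr ?nrm_ge0// exprn_ege1//; lra.
Unshelve. all: by end_near. Qed.

End IntegralMeans.

(** * Series of blocks with a dense orbit *)

Section BlockSeries.
Context {R : realType}.
Variables (alpha : R) (B : nat -> nat -> R[i]) (d : nat -> nat).
Variables (mu : nat -> nat) (rr : nat -> R).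
Implicit Types (z : R[i]) (s : R).

Definition block_poly j z := \sum_(0 <= k < d j) B j k * z ^+ k.

(** The sum of the moduli of the coefficients of the polynomial that starts at
    degree [m] and that [m] iterations of the shift map to [block_poly j]. *)
Definition block_norm j m : R :=
  \sum_(0 <= k < d j) nrm (B j k) * weight_ratio alpha k (k + m).

(** A closed form is possible because the gap required before block [j] depends
    on [j] alone: consecutive blocks do not overlap, and block [j] starts at
    least [mu j] after each earlier one. *)
Definition block_pos j : nat :=
  (\sum_(0 <= i < j.+1) (mu i).+1 + \sum_(0 <= i < j) d i)%N.

(** The contribution of block [j] to the coefficient of [z^k] in the [N]-th
    iterate. *)
Definition block_term N k j : R[i] :=
  if (block_pos j <= k + N < block_pos j + d j)%N then
    B j (k + N - block_pos j) * (weight_ratio alpha (k + N - block_pos j) k)%:C%C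
  else 0.

(** Block [j] starts at a position at least [j], so the blocks with [j <= m] are
    all those that can reach degree [m]. *)
Definition block_coef m : R[i] := \sum_(0 <= j < m.+1) block_term 0 m j.

Lemma weight_ratio_ge0 m k : 0 <= weight_ratio alpha m k.
Proof. exact: powR_ge0. Qed.

Lemma weight_ratioM l m k :
  weight_ratio alpha l m * weight_ratio alpha m k = weight_ratio alpha l k.
Proof.
rewrite /weight_ratio -powRM ?divr_ge0//; congr (_ `^ _).
by rewrite mulrA divfK// pnatr_eq0.
Qed.

Lemma weight_ratioxx k : weight_ratio alpha k k = 1.
Proof. by rewrite /weight_ratio divff ?pnatr_eq0// powR1. Qed.

Lemma block_norm_ge0 j m : 0 <= block_norm j m.
Proof. by apply: sumr_ge0 => k _; rewrite mulr_ge0 ?nrm_ge0 ?weight_ratio_ge0. Qed.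

Lemma block_posS i j : (i < j)%N -> (block_pos i + d i + mu j <= block_pos j)%N.
Proof.
move=> ij; rewrite /block_pos.
rewrite [X in (_ <= X + _)%N](@big_cat_nat _ _ _ j) //= big_nat1.
rewrite [X in (_ <= _ + _ + X)%N](@big_cat_nat _ _ _ i.+1) //= big_nat_recr //=.
rewrite [X in (_ <= X + _ + _)%N](@big_cat_nat _ _ _ i.+1) //=.
by rewrite !big_nat_recr //=; lia.
Qed.

Lemma block_pos_ge j : (mu j <= block_pos j)%N /\ (j <= block_pos j)%N.
Proof.
rewrite /block_pos; split; first by rewrite big_nat_recr //=; lia.
have : (\sum_(0 <= i < j.+1) 1 <= \sum_(0 <= i < j.+1) (mu i).+1)%N by apply: leq_sum.
by rewrite sum_nat_const_nat; lia.
Qed.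

Lemma shift_block_coef N k :
  block_coef (k + N) * (weight_ratio alpha (k + N) k)%:C%C =
  \sum_(0 <= j < (k + N).+1) block_term N k j.
Proof.
rewrite /block_coef mulr_suml; apply: eq_bigr => j _.
rewrite /block_term addn0; case: ifP => _; last by rewrite mul0r.
by rewrite -mulrA -rmorphM weight_ratioM.
Qed.

Lemma window_sum_le (F : nat -> R) K p n : (forall k, 0 <= F k) ->
  \sum_(0 <= k < K) (if (p <= k < p + n)%N then F (k - p)%N else 0) <=
  \sum_(0 <= k < n) F k.
Proof.
move=> F0; pose G k := if (p <= k < p + n)%N then F (k - p)%N else 0.
under eq_bigr do rewrite -/(G _).
have G0 k : 0 <= G k by rewrite /G; case: ifP.
apply: (@le_trans _ _ (\sum_(0 <= k < K + (p + n)) G k)).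
  by rewrite [leRHS](@big_cat_nat _ _ _ K) ?leq_addr//= lerDl sumr_ge0.
rewrite (@big_cat_nat _ _ _ p) //=; last by lia.
rewrite [X in _ + X](@big_cat_nat _ _ _ (p + n)) /= ?leq_addr//; last by lia.
rewrite big1_seq ?add0r; last first.
  by move=> k; rewrite mem_index_iota /G => /andP[_ /andP[_ kp]]; rewrite leqNgt kp.
rewrite [X in _ + X]big1_seq ?addr0; last first.
  move=> k; rewrite mem_index_iota /G => /andP[_ /andP[kp _]].
  by rewrite [(k < _)%N]ltnNge kp andbF.
rewrite -[p in X in X <= _]add0n big_addn addKn le_eqVlt; apply/orP; left; apply/eqP.
rewrite big_nat [RHS]big_nat; apply: eq_bigr => k /andP[_ kn].
by rewrite /G leq_addl addnC ltn_add2l kn addKn.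
Qed.

(** After [N] shifts a later block starts at degree [block_pos j - N], and
    [s^k] is at most [s] to that power over the whole block. *)
Lemma block_tail_le N J K s : 0 <= s -> s <= 1 ->
  (forall j, (J <= j)%N -> (N <= block_pos j)%N) ->
  \sum_(0 <= k < K) nrm (\sum_(J <= j < (k + N).+1) block_term N k j) * s ^+ k <=
  \sum_(J <= j < K + N) block_norm j (block_pos j - N) * s ^+ (block_pos j - N).
Proof.
move=> s0 s1 Npos.
apply: (@le_trans _ _ (\sum_(0 <= k < K) \sum_(J <= j < K + N)
    nrm (block_term N k j) * s ^+ k)).
  rewrite big_nat [leRHS]big_nat; apply: ler_sum => k /andP[_ kK].
  rewrite -mulr_suml ler_wpM2r ?exprn_ge0//; apply: le_trans (nrm_sum _ _ _) _.
  have [Jk|kJ] := leqP J (k + N).+1.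
    rewrite [leRHS](@big_cat_nat _ _ _ (k + N).+1) //=; last by lia.
    by rewrite lerDl sumr_ge0// => j _; exact: nrm_ge0.
  rewrite big_geq; last exact: ltnW.
  by apply: sumr_ge0 => j _; exact: nrm_ge0.
rewrite exchange_big_nat /= big_nat [leRHS]big_nat; apply: ler_sum => j /andP[Jj _].
have Nj := Npos j Jj; set p := (block_pos j - N)%N.
rewrite /block_norm mulr_suml.
pose F k := nrm (B j k) * weight_ratio alpha k (k + p) * s ^+ p.
apply: (@le_trans _ _ (\sum_(0 <= k < K) (if (p <= k < p + d j)%N then F (k - p)%N else 0))).
  apply: ler_sum => k _; rewrite /block_term.
  rewrite (_ : (block_pos j <= k + N < block_pos j + d j)%N = (p <= k < p + d j)%N); last first.
    by rewrite /p; apply/idP/idP; lia.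
  case: ifP => [/andP[pk _]|_]; last by rewrite Normc.normc0 mul0r.
  have -> : (k + N - block_pos j = k - p)%N by rewrite /p; lia.
  rewrite Normc.normcM nrmR ger0_norm ?weight_ratio_ge0// /F subnK//.
  by rewrite ler_wpM2l ?mulr_ge0 ?nrm_ge0 ?weight_ratio_ge0// ler_wiXn2l.
apply: window_sum_le => k.
by rewrite /F !mulr_ge0 ?nrm_ge0 ?weight_ratio_ge0 ?exprn_ge0.
Qed.

Hypothesis rr_ge0 : forall j, 0 <= rr j.
Hypothesis rr_to1 : forall j, 1 - j.+1%:R^-1 <= rr j.
Hypothesis block_small : forall j m, (mu j <= m)%N ->
  block_norm j m * rr j ^+ m <= 2^-1 ^+ j.

Lemma rr_ge i j s : (i <= j)%N -> s <= 1 - i.+1%:R^-1 -> s <= rr j.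
Proof.
move=> ij si; apply: le_trans (rr_to1 j); apply: le_trans si _.
by rewrite lerD2l lerN2 lef_pV2 ?posrE ?ltr0n// ler_nat.
Qed.

Lemma block_small_sum N J K s : 0 <= s -> s <= 1 - J.+1%:R^-1 ->
  (forall j, (J <= j)%N -> (N + mu j <= block_pos j)%N) ->
  \sum_(J <= j < K) block_norm j (block_pos j - N) * s ^+ (block_pos j - N) <=
  2 * 2^-1 ^+ J.
Proof.
move=> s0 sJ Npos.
apply: (@le_trans _ _ (\sum_(J <= j < K) 1 * 2^-1 ^+ j)); last first.
  apply: le_trans (geometric_sum_le J K (@ler01 R) _ _) _ => //; first by lra.
  by rewrite mul1r (_ : 1 - 2^-1 = 2^-1) ?invrK 1?mulrC//; field.
rewrite big_nat [leRHS]big_nat; apply: ler_sum => j /andP[Jj _].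
rewrite mul1r; have Nj := Npos j Jj.
apply: le_trans (block_small (_ : (mu j <= block_pos j - N)%N)); last by lia.
rewrite ler_wpM2l ?block_norm_ge0// lerXn2r ?nnegrE//; exact: rr_ge Jj sJ.
Qed.

Lemma archi_inv (e : R) : 0 < e -> exists N, forall n, (N <= n)%N -> n.+1%:R^-1 <= e.
Proof.
move=> e0; exists (Num.truncn e^-1) => n Nn.
rewrite -[leRHS]invrK lef_pV2 ?posrE ?invr_gt0 ?ltr0n//.
apply/ltW/(lt_le_trans (truncnS_gt e^-1)).
by rewrite ler_nat.
Qed.

Definition block_fun z : R[i] := limn (psums block_coef z).

Lemma psums_block_le z K : nrm z <= 1 -> nrm (psums block_coef z K) <=
  \sum_(0 <= j < K) block_norm j (block_pos j) * nrm z ^+ block_pos j.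
Proof.
move=> z1; have h := @block_tail_le 0 0 K (nrm z) (nrm_ge0 z) z1 (fun _ _ => leq0n _).
rewrite addn0 in h; apply: le_trans (le_trans _ h) _; last first.
  by apply: ler_sum => j _; rewrite subn0.
apply: le_trans (nrm_sum _ _ _) _; apply: ler_sum => k _.
by rewrite Normc.normcM nrmX addn0.
Qed.

Lemma block_disc_sum : disc_sum block_coef block_fun.
Proof.
move=> z z1; pose s := (1 + nrm z) / 2.
have n0 := nrm_ge0 z.
have s0 : 0 < s by rewrite /s; lra.
have s1 : s < 1 by rewrite /s; lra.
have zs : nrm z < s by rewrite /s; lra.
have [|J hJ] := @archi_inv (1 - s); first by rewrite subr_gt0.
have {}hJ : s <= 1 - J.+1%:R^-1 by rewrite lerBrDr -lerBrDl hJ.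
pose T j := block_norm j (block_pos j) * s ^+ block_pos j.
have T0 j : 0 <= T j by rewrite mulr_ge0 ?block_norm_ge0// exprn_ge0// ltW.
pose M := \sum_(0 <= j < J) T j + 2 * 2^-1 ^+ J.
have aM k : nrm (block_coef k) * s ^+ k <= M.
  have := @block_tail_le 0 0 k.+1 s (ltW s0) (ltW s1) (fun _ _ => leq0n _).
  rewrite addn0 big_nat_recr //= addn0 -/(block_coef k) => h.
  apply: (@le_trans _ _ (\sum_(0 <= j < k.+1) T j)).
    under eq_bigr do rewrite /T -(subn0 (block_pos _)).
    apply: le_trans h; rewrite lerDr; apply: sumr_ge0 => i _.
    by rewrite mulr_ge0 ?nrm_ge0// exprn_ge0// ltW.
  apply: (@le_trans _ _ (\sum_(0 <= j < J + k.+1) T j)).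
    by rewrite [leRHS](@big_cat_nat _ _ _ k.+1) ?leq_addl//= lerDl sumr_ge0.
  rewrite (@big_cat_nat _ _ _ J) ?leq_addr//= lerD2l /T.
  have := @block_small_sum 0 J (J + k.+1) s (ltW s0) hJ (fun j _ => (block_pos_ge j).1).
  by apply: le_trans; apply: ler_sum => j _; rewrite subn0.
have [l al _] := psums_cvg s0 zs aM.
by rewrite /block_fun (limC_eq al).
Qed.

Lemma block_fun_le z (C : R) : nrm z < 1 ->
  (forall K, \sum_(0 <= j < K) block_norm j (block_pos j) * nrm z ^+ block_pos j <= C) ->
  nrm (block_fun z) <= C.
Proof.
move=> z1 hC; rewrite -[block_fun z]subr0.
apply: (cvgC_bound (block_disc_sum z1) (N := 0)) => K _.
by rewrite subr0; apply: le_trans (psums_block_le K (ltW z1)) (hC K).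
Qed.

(** Shifting by [block_pos J] deletes the blocks before [J], brings block [J]
    back to [block_poly J], and leaves the later blocks at least [mu j] away
    from degree [0], where they are small. *)
Lemma iter_block_fun J z : nrm z <= 1 - J.+1%:R^-1 ->
  nrm (iter (block_pos J) (taylor_shift alpha) block_fun z - block_poly J z) <= 2^-1 ^+ J.
Proof.
move=> zJ; set N := block_pos J.
have i0 : 0 < J.+1%:R^-1 :> R by rewrite invr_gt0 ltr0n.
have z1 : nrm z < 1 by apply: le_lt_trans zJ _; rewrite ltrBlDr ltrDl.
have Tf := @disc_sum_iter _ alpha _ _ N block_disc_sum z z1.
apply: (cvgC_bound Tf (N := d J)) => K dK.
have JN : (J <= N)%N := (block_pos_ge J).2.
have coefE k : block_coef (k + N) * (weight_ratio alpha (k + N) k)%:C%C =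
    (if (k < d J)%N then B J k else 0) + \sum_(J.+1 <= j < (k + N).+1) block_term N k j.
  rewrite shift_block_coef (@big_cat_nat _ _ _ J) //=; last by lia.
  rewrite big1_seq ?add0r; last first.
    move=> j; rewrite mem_index_iota /block_term => /andP[_ /andP[_ jJ]].
    have := block_posS jJ; rewrite -/N => h.
    have h' : (block_pos j + d j <= k + N)%N by lia.
    by rewrite [(_ < block_pos j + _)%N]ltnNge h' andbF.
  rewrite big_ltn; last by lia.
  congr (_ + _); rewrite /block_term -/N leq_addl addnC ltn_add2l addKn /=.
  by rewrite weight_ratioxx mulr1.
have -> : psums (fun k => block_coef (k + N) * (weight_ratio alpha (k + N) k)%:C%C) z K
    - block_poly J z = \sum_(0 <= k < K)
      (\sum_(J.+1 <= j < (k + N).+1) block_term N k j) * z ^+ k.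
  rewrite /psums /series /=; under eq_bigr do rewrite coefE mulrDl.
  rewrite big_split /= addrAC [X in X - _ + _](_ : _ = block_poly J z) ?subrr ?add0r//.
  rewrite (@big_cat_nat _ _ _ (d J)) //= [X in _ + X]big1_seq ?addr0.
    by rewrite big_nat [RHS]big_nat; apply: eq_bigr => k /andP[_ ->].
  move=> k; rewrite mem_index_iota => /andP[_ /andP[kd _]].
  by rewrite ltnNge kd mul0r.
apply: le_trans (nrm_sum _ _ _) _.
under eq_bigr do rewrite Normc.normcM nrmX.
apply: le_trans (@block_tail_le N J.+1 K (nrm z) (nrm_ge0 z) (ltW z1) _) _.
  by move=> j Jj; have := block_posS Jj; rewrite -/N; lia.
apply: le_trans (block_small_sum (K + N) (nrm_ge0 z) _ _) _.
- by apply: le_trans zJ _; rewrite lerD2l lerN2 lef_pV2 ?posrE ?ltr0n// ler_nat.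
- by move=> j Jj; have := block_posS Jj; rewrite -/N; lia.
by rewrite exprS mulrA divff ?mul1r.
Qed.

Hypothesis block_dense : forall g r e N, HD g -> r < 1 -> 0 < e ->
  exists2 j, (N <= j)%N & forall z, nrm z <= r -> nrm (block_poly j z - g z) <= e.

Lemma infinite_nat_cofinal (S : set nat) :
  (forall N, exists2 n, (N <= n)%N & S n) -> infinite_set S.
Proof.
move=> hS /finite_seqP[s Ss].
have [n ns] := hS (\max_(i <- s) i).+1; rewrite Ss /= => nS.
by have := @leq_bigmax_seq _ s xpredT (fun i => i) n nS isT; rewrite /= leqNgt ns.
Qed.

(** Along indices [j n >= n] for which [block_poly (j n)] tends to a given [g],
    the iterates at [block_pos (j n)] tend to [g] as well. *)
Theorem block_fun_hypercyclic : hypercyclic alpha block_fun.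
Proof.
split; first exact: disc_sum_HD block_disc_sum.
move=> U oU [g Ug].
have HDg : HD g by case: oU Ug => V _ -> [].
have i0 n : 0 < n.+1%:R^-1 :> R by rewrite invr_gt0 ltr0n.
have /choice[j hj] : forall n, exists j, (n <= j)%N /\
    forall z, nrm z <= 1 - n.+1%:R^-1 -> nrm (block_poly j z - g z) <= n.+1%:R^-1.
  move=> n; have [|j nj jP] := @block_dense g (1 - n.+1%:R^-1) n.+1%:R^-1 n HDg _ (i0 n).
    by rewrite ltrBlDr ltrDl.
  by exists j.
pose h n := iter (block_pos (j n)) (taylor_shift alpha) block_fun.
have hU : \forall n \near \oo, U (h n); last first.
  case: hU => N _ hN; apply: infinite_nat_cofinal => m.
  exists (block_pos (j (maxn N m))); last by apply: hN => /=; exact: leq_maxl.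
  have [h1 _] := hj (maxn N m); have := (block_pos_ge (j (maxn N m))).2.
  by have := leq_maxr N m; lia.
apply: (HD_open_eventually oU Ug).
- by move=> n; apply: disc_sum_HD (@disc_sum_iter _ alpha _ _ _ block_disc_sum).
- move=> r e r1 e0.
  have [|N1 hN1] := @archi_inv (1 - r); first by rewrite subr_gt0.
  have [|N2 hN2] := @archi_inv (e / 4); first by rewrite divr_gt0.
  exists (maxn N1 N2) => // n /=; rewrite geq_max => /andP[/hN1 n1 /hN2 n2] z zr.
  have [nj jP] := hj n.
  have [y yE] : exists y : R, n.+1%:R^-1 = y by exists n.+1%:R^-1.
  rewrite yE in n1 n2 jP.
  have h1 : nrm (block_poly (j n) z - g z) <= y by apply: jP; lra.
  have h2 := @iter_block_fun (j n) z.
  have h3 : 2^-1 ^+ j n <= y.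
    rewrite -yE exprVn lef_pV2 ?posrE ?ltr0n ?exprn_gt0//.
    by rewrite -natrX ler_nat; apply: leq_trans (ltn_expl _ _).
  have h4 : nrm z <= 1 - (j n).+1%:R^-1.
    apply: (@le_trans _ _ (1 - y)); first lra.
    by rewrite -yE lerD2l lerN2 lef_pV2 ?posrE ?ltr0n// ler_nat.
  have := nrmD (iter (block_pos (j n)) (taylor_shift alpha) block_fun z -
    block_poly (j n) z) (block_poly (j n) z - g z).
  by rewrite addrA subrK; have := h2 h4; lra.
Qed.

End BlockSeries.

(** * Placing the rational blocks *)

Section RationalBlocks.
Context {R : realType}.
Implicit Types (g : R[i] -> R[i]) (z : R[i]) (r e x beta alpha : R) (j k m n N : nat).

(** The natural number coded together with the list is discarded; it makes each
    list occur at infinitely many indices. *)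
Definition rational_block j : seq (rat * rat) :=
  oapp fst [::] (unpickle j : option (seq (rat * rat) * nat)).

Definition block_size j := size (rational_block j).

Definition gaussian (q : rat * rat) : R[i] := (ratr q.1 +i* ratr q.2)%C.

Definition block_entry j k : R[i] := gaussian (nth (0, 0) (rational_block j) k).

Lemma gaussian_dense (w : R[i]) e : 0 < e -> exists q, nrm (gaussian q - w) <= e.
Proof.
move=> e0; have e2 : 0 < e / 2 by rewrite divr_gt0.
have approx (x : R) : exists q : rat, `|ratr q - x| <= e / 2.
  have /rat_in_itvoo[q] : x - e / 2 < x + e / 2 by lra.
  by rewrite in_itv /= => /andP[h1 h2]; exists q; rewrite ler_norml; lra.
have [q1 h1] := approx (complex.Re w); have [q2 h2] := approx (complex.Im w).
exists (q1, q2); apply: le_trans (nrm_le _) _; rewrite [e]splitr.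
by case: w h1 h2 => x y h1 h2; apply: lerD.
Qed.

Lemma rational_block_cofinal (s : seq (rat * rat)) N :
  exists2 j, (N <= j)%N & rational_block j = s.
Proof.
have [h|/existsNP[j /not_implyP[Nj /contrapT js]]] :=
  pselect (forall j, (N <= j)%N -> rational_block j <> s); last by exists j.
pose F (i : 'I_N.+1) : nat := pickle (s, i : nat).
have blockF i : rational_block (F i) = s by rewrite /rational_block /F pickleK.
have FN i : (F i < N)%N.
  by rewrite ltnNge; apply/negP => /h; rewrite blockF.
have injF : injective (fun i => Ordinal (FN i)).
  move=> i i' /(congr1 val) /= /(pcan_inj (@pickleK _)) [] ii'.
  exact: val_inj.
by have := leq_card _ injF; rewrite !card_ord ltnn.
Qed.

Lemma block_poly_dense g r e N : HD g -> r < 1 -> 0 < e -> exists2 j, (N <= j)%N &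
  forall z, nrm z <= r -> nrm (block_poly block_entry block_size j z - g z) <= e.
Proof.
move=> /global_taylor[b bg] r1 e0.
have [r0|r0] := ltP r 0.
  by exists N => // z zr; have := nrm_ge0 z; lra.
pose s := (1 + r) / 2.
have s0 : 0 < s by rewrite /s; lra.
have s1 : s < 1 by rewrite /s; lra.
have rs : r < s by rewrite /s; lra.
have [M bM] := disc_sum_coef_bound bg (ltW s0) s1.
have M0 : 0 <= M by have := bM 0%N; rewrite expr0 mulr1; apply: le_trans; exact: nrm_ge0.
have q0 : 0 <= r / s by rewrite divr_ge0// ltW.
have q1 : r / s < 1 by rewrite ltr_pdivrMr// mul1r.
have e2 : 0 < e / 2 by rewrite divr_gt0.
have [K hK] : exists K, M * (r / s) ^+ K / (1 - r / s) <= e / 2.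
  have := @cvg_geometric _ (M / (1 - r / s)) (r / s).
  rewrite ger0_norm// => /(_ q1) /(cvgr0Pnorm_le _) /(_ _ e2) [K _ /(_ K (leqnn K)) /=] hK.
  by exists K; rewrite mulrAC; apply: le_trans (ler_norm _) hK.
have eK : 0 < e / 2 / K.+1%:R by rewrite divr_gt0.
have /choice[q hq] : forall k, exists q, nrm (gaussian q - b k) <= e / 2 / K.+1%:R.
  by move=> k; exact: gaussian_dense.
have [j Nj jq] := rational_block_cofinal (mkseq q K) N.
exists j => // z zr.
have -> : block_poly block_entry block_size j z = \sum_(0 <= k < K) gaussian (q k) * z ^+ k.
  rewrite /block_poly /block_size jq size_mkseq big_nat [RHS]big_nat.
  by apply: eq_bigr => k /andP[_ kK]; rewrite /block_entry jq nth_mkseq.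
have z1 : nrm z < 1 by lra.
have zs : nrm z < s by lra.
have [l al lB] := psums_cvg s0 zs bM.
rewrite (cvgC_unique (bg z z1) al).
rewrite (_ : _ - l = (\sum_(0 <= k < K) gaussian (q k) * z ^+ k - psums b z K) +
  (psums b z K - l)); last by ring.
apply: le_trans (nrmD _ _) _; rewrite [e]splitr; apply: lerD; last first.
  apply: le_trans (lB K) _; apply: le_trans hK.
  have zr' : nrm z / s <= r / s by rewrite ler_pM2r ?invr_gt0.
  have z0 : 0 <= nrm z / s by rewrite divr_ge0 ?nrm_ge0// ltW.
  apply: ler_pM; rewrite ?invr_ge0 ?subr_ge0 ?mulr_ge0 ?exprn_ge0//; first lra.
    by rewrite ler_wpM2l// lerXn2r ?nnegrE.
  by rewrite lef_pV2 ?posrE ?subr_gt0//; lra.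
rewrite /psums /series /= -sumrB; apply: le_trans (nrm_sum _ _ _) _.
apply: (@le_trans _ _ (\sum_(0 <= k < K) e / 2 / K.+1%:R)); last first.
  rewrite sumr_const_nat subn0 -(mulr_natr (e / 2 / K.+1%:R)) -[leLHS]mulrA ler_piMr ?(ltW e2)//.
  by rewrite mulrC ler_pdivrMr ?ltr0n// mul1r ler_nat.
apply: ler_sum => k _; rewrite -mulrBl Normc.normcM nrmX.
rewrite -[leRHS]mulr1; apply: ler_pM; rewrite ?nrm_ge0 ?exprn_ge0 ?nrm_ge0//.
by rewrite exprn_ile1 ?nrm_ge0// ltW.
Qed.

Definition block_mass j : R := \sum_(0 <= k < block_size j) nrm (block_entry j k).

Lemma block_mass_ge0 j : 0 <= block_mass j.
Proof. by apply: sumr_ge0 => k _; exact: nrm_ge0. Qed.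

Local Notation bnorm alpha := (block_norm alpha block_entry block_size).
Local Notation bpos := (block_pos block_size).
Local Notation bfun alpha := (block_fun alpha block_entry block_size).

Lemma block_norm_le alpha j m (c : R) :
  (forall k, (k < block_size j)%N -> weight_ratio alpha k (k + m) <= c) ->
  bnorm alpha j m <= block_mass j * c.
Proof.
move=> hc; rewrite /block_mass mulr_suml /block_norm big_nat [leRHS]big_nat.
by apply: ler_sum => k /andP[_ /hc kc]; rewrite ler_wpM2l ?nrm_ge0.
Qed.

Lemma sum_half_le K : \sum_(0 <= j < K) 2^-1 ^+ j <= 2 :> R.
Proof.
have h : 2^-1 < 1 :> R by lra.
have := geometric_sum_le 0 K (@ler01 R) (_ : 0 <= 2^-1) h.
rewrite expr0 mulr1 div1r (_ : 1 - 2^-1 = 2^-1) ?invrK; last by field.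
under eq_bigr do rewrite mul1r.
by apply; rewrite invr_ge0.
Qed.

(** For [alpha > 0] the norm of a block tends to [0] when it is moved to the
    right, so all blocks may be placed where their norms are summable. *)
Lemma bounded_hypercyclic alpha : 0 < alpha ->
  exists f, [/\ hypercyclic alpha f, exists a, disc_sum a f &
    forall z, nrm z < 1 -> nrm (f z) <= 2].
Proof.
move=> alpha0.
have /choice[mu hmu] : forall j, exists mu, forall m, (mu <= m)%N -> bnorm alpha j m <= 2^-1 ^+ j.
  move=> j; pose c : R := 2^-1 ^+ j / (block_mass j + 1).
  have A1 : 0 < block_mass j + 1 by rewrite ltr_wpDl// block_mass_ge0.
  have c0 : 0 < c by rewrite divr_gt0// exprn_gt0 ?invr_gt0.
  have [|N hN] := @archi_inv R (c `^ alpha^-1 / (block_size j).+1%:R).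
    by rewrite divr_gt0 ?powR_gt0.
  exists N => m /hN; rewrite ler_pdivlMr ?ltr0n// => hm.
  apply: (@le_trans _ _ (block_mass j * c)); last first.
    rewrite /c mulrCA ler_piMr ?exprn_ge0 ?invr_ge0//.
    by rewrite ler_pdivrMr// mul1r lerDl.
  apply: block_norm_le => k kj; rewrite /weight_ratio.
  have -> : c = (c `^ alpha^-1) `^ alpha.
    by rewrite -powRrM mulVf ?gt_eqF// powRr1// ltW.
  apply: ge0_ler_powR; rewrite ?nnegrE ?powR_ge0 ?divr_ge0 ?(ltW alpha0)//.
  apply: le_trans hm; rewrite mulrC.
  apply: ler_pM; rewrite ?invr_ge0 ?ler0n//; last by rewrite ler_nat; lia.
  by rewrite lef_pV2 ?posrE ?ltr0n// ler_nat; lia.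
pose rr j : R := 1 - j.+1%:R^-1.
have rr0 j : 0 <= rr j by rewrite subr_ge0 invf_le1 ?ltr0n// ler1n.
have rr1 j : rr j <= 1 by rewrite gerBl invr_ge0.
have small j m : (mu j <= m)%N -> bnorm alpha j m * rr j ^+ m <= 2^-1 ^+ j.
  move=> /hmu; apply: le_trans; rewrite ler_piMr ?block_norm_ge0//.
  by rewrite exprn_ile1.
have rrle j : 1 - j.+1%:R^-1 <= rr j by [].
exists (bfun alpha mu); split.
- exact: (block_fun_hypercyclic rr0 rrle small block_poly_dense).
- by eexists; exact: (block_disc_sum rr0 rrle small).
move=> z z1; apply: (block_fun_le rr0 rrle small z1) => K.
apply: le_trans (sum_half_le K); apply: ler_sum => j _.
apply: le_trans (hmu j _ (block_pos_ge block_size mu j).1).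
by rewrite ler_piMr ?block_norm_ge0// exprn_ile1 ?nrm_ge0// ltW.
Qed.

Lemma powR_le_expR beta : 0 <= beta ->
  forall x, 0 <= x -> x `^ beta <= beta `^ beta * expR x.
Proof.
rewrite le_eqVlt => /predU1P[<- x x0|b0 x x0].
  by rewrite !powRr0 mul1r; apply: le_trans (expR_ge1Dx x); rewrite lerDl.
have h : x <= beta * expR (x / beta).
  rewrite mulrC -ler_pdivrMr//; apply: le_trans (expR_ge1Dx _).
  by rewrite lerDr.
apply: le_trans (ge0_ler_powR (ltW b0) _ _ h) _; rewrite ?nnegrE//.
  by rewrite mulr_ge0 ?expR_ge0// ltW.
have e0 : expR (x / beta) `^ beta = expR x.
  by rewrite -expRM divfK// gt_eqF.
by rewrite (powRM _ (ltW b0) (expR_ge0 _)) e0.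
Qed.

(** The maximum of [m^beta r^m] over [m] is of the order of [(1 - r)^-beta]:
    put [x = m (1 - r)] and use [r <= exp (r - 1)]. *)
Lemma powR_geometric_le beta r m : 0 <= beta -> 0 <= r -> r < 1 ->
  m%:R `^ beta * r ^+ m <= beta `^ beta * (1 - r) `^ (- beta).
Proof.
move=> b0 r0 r1; have s0 : 0 < 1 - r by rewrite subr_gt0.
have h := powR_le_expR b0 (_ : 0 <= m%:R * (1 - r)).
have {h} := h (mulr_ge0 (ler0n _ _) (ltW s0)).
rewrite powRM ?ler0n ?(ltW s0)// powRN ler_pdivlMr ?powR_gt0// => h.
have hr : r ^+ m <= expR (- (m%:R * (1 - r))).
  rewrite -mulrN mulrC expRM_natr; apply: lerXn2r; rewrite ?nnegrE ?expR_ge0//.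
  by apply: le_trans (expR_ge1Dx _); lra.
rewrite mulrAC; apply: le_trans (ler_pM _ _ h hr) _.
- by rewrite mulr_ge0 ?powR_ge0.
- exact: exprn_ge0.
by rewrite -mulrA -expRD subrr expR0 mulr1.
Qed.

Lemma block_norm_growth alpha j m r : alpha <= 0 -> (block_size j <= m)%N ->
  0 <= r -> r < 1 ->
  bnorm alpha j m * r ^+ m <=
  block_mass j * (2 `^ (- alpha) * (- alpha) `^ (- alpha)) * (1 - r) `^ alpha.
Proof.
move=> a0 jm r0 r1; have b0 : 0 <= - alpha by rewrite oppr_ge0.
apply: (@le_trans _ _ (block_mass j * (2 * m%:R) `^ (- alpha) * r ^+ m)).
  rewrite ler_wpM2r ?exprn_ge0//; apply: block_norm_le => k kj.
  have x0 : 0 <= k.+1%:R / (k + m).+1%:R :> R by rewrite divr_ge0.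
  have -> : weight_ratio alpha k (k + m) = ((k + m).+1%:R / k.+1%:R) `^ (- alpha).
    by rewrite -invf_div -(powR_inv1 x0) -powRrM mulN1r opprK.
  apply: ge0_ler_powR; rewrite ?nnegrE ?divr_ge0 ?mulr_ge0//.
  rewrite ler_pdivrMr ?ltr0n// -natrM -natrM ler_nat; nia.
rewrite powRM ?ler0n// -!mulrA ler_wpM2l ?block_mass_ge0// ler_wpM2l ?powR_ge0//.
by have := powR_geometric_le m b0 r0 r1; rewrite opprK.
Qed.

(** For [alpha <= 0] each block contributes at most a constant multiple of
    [(1 - r)^alpha], and only [2^-j] until [r] exceeds the number [rr j], where
    [phi] dominates the sum of the first constants. *)
Lemma slow_growth_hypercyclic alpha (phi : R -> R) : alpha <= 0 ->
  (forall r, 0 <= r < 1 -> 0 <= phi r) -> phi r @[r --> 1^'-] --> +oo ->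
  exists f, [/\ hypercyclic alpha f, exists a, disc_sum a f &
    exists2 C, 0 < C & \forall r \near 1^'-, [/\ 0 < r, r < 1 &
      forall z, nrm z = r -> nrm (f z) <= C * phi r * (1 - r) `^ alpha]].
Proof.
move=> a0 phi0 phioo.
pose D : R := 2 `^ (- alpha) * (- alpha) `^ (- alpha).
have D0 : 0 <= D by rewrite mulr_ge0 ?powR_ge0.
have phige (c : R) : \forall r \near 1^'-, c <= phi r.
  by move/cvgryPge : phioo; apply.
have /choice[rr hrr] : forall j, exists s, [/\ 0 <= s < 1, 1 - j.+1%:R^-1 <= s &
    forall r, s <= r -> r < 1 -> \sum_(0 <= i < j.+1) block_mass i <= phi r].
  move=> j; have := phige (\sum_(0 <= i < j.+1) block_mass i).
  case=> e /= e0 he.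
  (* [e / 2] because [he] needs points strictly closer to [1] than [e]. *)
  exists (Num.max (1 - e / 2) (1 - j.+1%:R^-1)).
  have j1 : j.+1%:R^-1 <= 1 :> R by rewrite invf_le1 ?ltr0n// ler1n.
  have j0 : 0 < j.+1%:R^-1 :> R by rewrite invr_gt0.
  split.
  - rewrite le_max gt_max !ltrBlDr !ltrDl divr_gt0// j0 andbT.
    by rewrite [X in _ || X]subr_ge0 j1 orbT.
  - by rewrite le_max lexx orbT.
  move=> r; rewrite ge_max => /andP[h1 h2] r1; apply: he => //.
  by rewrite /ball /= ger0_norm ?subr_ge0 ?ltW//; lra.
have rr0 j : 0 <= rr j by have [/andP[]] := hrr j.
have rr1 j : rr j < 1 by have [/andP[]] := hrr j.
have rrle j : 1 - j.+1%:R^-1 <= rr j by have [] := hrr j.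
have /choice[mu hmu] : forall j, exists mu, forall m, (mu <= m)%N ->
    (block_size j <= m)%N /\ bnorm alpha j m * rr j ^+ m <= 2^-1 ^+ j.
  (* The growth bound at a radius [s > rr j] leaves a factor [(rr j / s)^m]. *)
  move=> j; pose s := (1 + rr j) / 2.
  have h0 := rr0 j; have h1 := rr1 j.
  have s0 : 0 < s by rewrite /s; lra.
  have s1 : s < 1 by rewrite /s; lra.
  have rs : rr j < s by rewrite /s; lra.
  pose c := block_mass j * D * (1 - s) `^ alpha.
  have q0 : 0 <= rr j / s by rewrite divr_ge0// ltW.
  have q1 : rr j / s < 1 by rewrite ltr_pdivrMr// mul1r.
  have e0 : 0 < 2^-1 ^+ j :> R by rewrite exprn_gt0// invr_gt0.
  have := @cvg_geometric _ c (rr j / s).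
  rewrite ger0_norm// => /(_ q1) /(cvgr0Pnorm_le _) /(_ _ e0)[N _ hN].
  exists (maxn N (block_size j)) => m; rewrite geq_max => /andP[Nm jm]; split=> //.
  have := hN m Nm => /=; apply: le_trans; apply: le_trans (ler_norm _).
  rewrite (_ : rr j ^+ m = s ^+ m * (rr j / s) ^+ m); last first.
    by rewrite -exprMn mulrCA divff ?mulr1// gt_eqF.
  rewrite mulrA ler_wpM2r ?exprn_ge0//.
  exact: block_norm_growth (ltW s0) s1.
have small j m : (mu j <= m)%N -> bnorm alpha j m * rr j ^+ m <= 2^-1 ^+ j.
  by move=> /hmu[].
exists (bfun alpha mu); split.
- exact: (block_fun_hypercyclic rr0 rrle small block_poly_dense).
- by eexists; exact: (block_disc_sum rr0 rrle small).
exists (D + 2); first by rewrite ltr_wpDl.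
near=> r.
have r1 : r < 1 by near: r; exact: nbhs_left_lt.
have r0 : 0 < r by near: r; exact: nbhs_left_gt.
have phi1 : 1 <= phi r by near: r; exact: phige.
split=> // z zr.
have z1 : nrm z < 1 by rewrite zr.
apply: (block_fun_le rr0 rrle small z1) => K; rewrite zr.
have w1 : 1 <= (1 - r) `^ alpha.
  apply: (@le_trans _ _ ((1 - r) `^ 0)); first by rewrite powRr0.
  by apply: ger_powR => //; rewrite subr_gt0 r1 gerBl ltW.
(* The last index [j] with [rr j <= r] accounts for all the masses before it. *)
have sumA : \sum_(0 <= j < K) (if rr j <= r then block_mass j else 0) <= phi r.
  elim: K => [|K IH]; first by rewrite big_geq//; lra.
  rewrite big_nat_recr //=; case: ifPn => [rK|_]; last by rewrite addr0.
  have [_ _ /(_ r rK r1)] := hrr K; apply: le_trans.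
  rewrite [leRHS]big_nat_recr //= lerD2r; apply: ler_sum => j _.
  by case: ifP => // _; exact: block_mass_ge0.
apply: (@le_trans _ _ (\sum_(0 <= j < K)
   ((if rr j <= r then block_mass j else 0) * (D * (1 - r) `^ alpha) + 2^-1 ^+ j))).
  apply: ler_sum => j _.
  have [jm jsmall] := hmu j _ (block_pos_ge block_size mu j).1.
  have e0 : 0 <= 2^-1 ^+ j :> R by rewrite exprn_ge0// invr_ge0.
  case: ifPn => [_|]; last first.
    rewrite -ltNge mul0r add0r => rj; apply: le_trans jsmall.
    by rewrite ler_wpM2l ?block_norm_ge0// lerXn2r ?nnegrE ?(ltW r0) ?rr0 ?(ltW rj).
  apply: le_trans (block_norm_growth a0 jm (ltW r0) r1) _.
  by rewrite -mulrA lerDl.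
rewrite big_split /= -mulr_suml.
have h1 := ler_wpM2r (mulr_ge0 D0 (le_trans ler01 w1)) sumA.
have h2 := sum_half_le K.
have h3 : 1 <= phi r * (1 - r) `^ alpha by rewrite mulr_ege1.
rewrite -mulrA mulrDl; apply: lerD.
  by apply: le_trans h1 _; rewrite mulrCA.
by apply: le_trans h2 _; rewrite ler_peMr.
Unshelve. all: by end_near. Qed.

End RationalBlocks.

(** * The growth of hypercyclic functions *)

Theorem theorem2p2 (R : realType) (p : \bar R) (hp : (1 <= p)%E) :
  (forall alpha : R, alpha <= 0 ->
     (forall phi : R -> R,
        (forall r, 0 <= r < 1 -> 0 <= phi r) ->
        phi r @[r --> 1^'-] --> +oo ->
        exists f : R[i] -> R[i], hypercyclic alpha f /\
          exists2 C : R, 0 < C &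
            \forall r \near 1^'-, Mp p f r <= C * phi r * (1 - r) `^ alpha)
     /\
     ~ (exists f : R[i] -> R[i], hypercyclic alpha f /\
          exists2 C : R, 0 < C &
            forall r, 0 < r < 1 -> Mp p f r <= C * (1 - r) `^ alpha))
  /\
  (forall alpha : R, 0 < alpha ->
     (exists f : R[i] -> R[i], hypercyclic alpha f /\
        exists2 C : R, 0 < C & forall r, 0 < r < 1 -> Mp p f r <= C)
     /\
     (forall phi : R -> R,
        (forall r, 0 <= r < 1 -> 0 <= phi r) ->
        phi r @[r --> 1^'-] --> 0 ->
        ~ (exists f : R[i] -> R[i], hypercyclic alpha f /\
             forall r, 0 < r < 1 -> Mp p f r <= phi r))).
Proof.
split=> alpha halpha; split.
- move=> phi phi0 phioo.
  have [f [hf [a af] [C C0 hC]]] := slow_growth_hypercyclic halpha phi0 phioo.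
  exists f; split=> //; exists C => //.
  by apply: filterS hC => r [r0 r1 fr]; exact: Mp_le hp r0 r1 af fr.
- by move=> [f [hf [C C0 hC]]]; exact: no_slow_growth hp C0 hf hC.
- have [f [hf [a af] f2]] := bounded_hypercyclic halpha.
  exists f; split=> //; exists 2 => // r /andP[r0 r1].
  by apply: (Mp_le hp r0 r1 af) => z zr; apply: f2; rewrite zr.
- by move=> phi _ phi0 [f [hf hphi]]; exact: no_decay hp hf phi0 hphi.
Qed.
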